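(* Fix $\lambda\in\mathbb R$ and let $K\subset E=(0,\infty)\times\mathbb Z_{\ge0}$ be compact. (a) There are $C_K,c_K>0$ such that, for all $n\ge n_\lambda$ and $m\ge1$, $$\mathbb P\{\Xi_n(K)\ge m\}\le\frac{C_K^m}{m!}e^{-c_Km^3}.$$ (b) For bounded Borel measurable $h:E\to\mathbb C$ with $\operatorname{supp}h\subset K$, define $G_n(h)=\mathbb E\prod_{z\in\Xi_n}(1+h(z))$, where atoms are counted with multiplicity. Then $$G_n(h)=\sum_{q=0}^\infty\frac1{q!}\int_{E^q}\prod_{i=1}^qh(z_i)\,\mathrm d\alpha_{\Xi_n}^{(q)}(z_1,\dots,z_q).$$ (c) For every $T<\infty$ there are $A=A(K,T)<\infty$ and $d=d(K,T)>0$ such that, for every $Q\in\mathbb Z_{\ge0}$, $$\sup_{\substack{n\ge n_\lambda,\ \operatorname{supp}h\subset K\\ \|h\|_\infty\le T}}\left|G_n(h)-\sum_{q=0}^Q\frac1{q!}\int_{E^q}\prod_{i=1}^qh(z_i)\,\mathrm d\alpha_{\Xi_n}^{(q)}(z_1,\dots,z_q)\right|\le Ae^{-dQ^3},$$ the supremum being over $n$ and bounded Borel $h:E\to\mathbb C$. (d) For every Borel set $B\subset K$, the choice $h=-\mathbf 1_B$ gives $$\sup_{n\ge n_\lambda}\left|\mathbb P\{\Xi_n(B)=0\}-\sum_{q=0}^Q\frac{(-1)^q}{q!}\mathbb E[(\Xi_n(B))_q]\right|\le Ae^{-dQ^3},\qquad Q\in\mathbb Z_{\ge0},$$ where $A,d$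 may be taken from (c) with $T=1$. (e) If $f:E\to\mathbb C$ is bounded and Borel measurable with $\operatorname{supp}f\subset K$, then the estimate in (c) also applies to the complex local Laplace functional $\mathbb E e^{-\langle f,\Xi_n\rangle}=G_n(e^{-f}-1)$, on taking $h=e^{-f}-1$. In particular, for every $t\ge0$, $$\sup_{n\ge n_\lambda}\mathbb E e^{t\Xi_n(K)}<\infty.$$
   Context: Put $p_n=n^{-1}+\lambda n^{-4/3}$ and let $n_\lambda$ be a fixed integer with $p_n\in(0,1)$ for all $n\ge n_\lambda$. $G(n,p)$ is the Erdős–Rényi random graph, $\mathcal C(G)$ the set of connected components of $G$; for a component $C$, $|C|$ and $e(C)$ are its numbers of vertices and edges, and $\operatorname{sp}(C)=e(C)-|C|+1$. $E=(0,\infty)\times\mathbb Z_{\ge0}$ has the product topology ($\mathbb Z_{\ge0}$ discrete), and $\Xi_n=\sum_{C\in\mathcal C(G(n,p_n))}\delta_{(n^{-2/3}|C|,\operatorname{sp}(C))}$. The $q$th factorial moment measure $\alpha_{\Xi}^{(q)}$ of a point process $\Xi$ is defined by $\int_{E^q}H\,\mathrm d\alpha_{\Xi}^{(q)}=\mathbb E\sum^{\ne}_{z_1,\dots,z_q\in\Xi}H(z_1,\dots,z_q)$ for nonnegative measurable $H$, the sum being over ordered tuples of distinct atom indices (atoms at the same location are distinguished by multiplicity index); $\alpha_\Xi^{(0)}$ is unit mass on the singleton $E^0$, and empty products equal one, so $q=0$ terms equal one. Notation: $(m)_q=m(m-1)\cdots(m-q+1)$ with $(m)_0=1$; $\langle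 f,\xi\rangle=\int f\,\mathrm d\xi$. *)

(* Defs.v *)
From HB Require Import structures.
From mathcomp Require Import all_boot all_order all_algebra complex.
From mathcomp Require Import all_classical all_reals all_analysis measurable_realfun.

Set Implicit Arguments.
Unset Strict Implicit.
Unset Printing Implicit Defensive.

Import Order.TTheory GRing.Theory Num.Theory.
Import numFieldNormedType.Exports.

Local Open Scope classical_set_scope.
Local Open Scope ring_scope.
Local Open Scope complex_scope.

Definition cnorm (R : realType) (z : R[i]) : R := ComplexField.Normc.normc z.

Definition cexp (R : realType) (z : R[i]) : R[i] :=
  (expR (complex.Re z))%:C * (cos (complex.Im z) +i* sin (complex.Im z)).

Definition complex_integral d (T : measurableType d) (R : realType)
    (mu : {measure set T -> \bar R}) (f : T -> R[i]) : R[i] :=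
  (\int[mu]_x complex.Re (f x)) +i* (\int[mu]_x complex.Im (f x)).

Section finite_measure_sum.
Local Open Scope ereal_scope.
Context d (T : measurableType d) (R : realType) (I : finType) (P : pred I).
Variable m : I -> {measure set T -> \bar R}.

Definition fin_msum (A : set T) : \bar R := \sum_(i | P i) m i A.

Let fin_msum0 : fin_msum set0 = 0.
Proof. by rewrite /fin_msum big1. Qed.

Let fin_msum_ge0 A : 0 <= fin_msum A.
Proof. by apply: sume_ge0 => i _; exact: measure_ge0. Qed.

Let fin_msum_sigma_additive : semi_sigma_additive fin_msum.
Proof.
move=> F mF tF mUF; rewrite [X in _ --> X](_ : _ =
    lim ((fun n => \sum_(0 <= i < n) fin_msum (F i)) @ \oo)).
  by apply: is_cvg_ereal_nneg_natsum => k _; exact: sume_ge0.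
rewrite nneseries_sum//; apply: eq_bigr => /= i _.
exact: measure_semi_bigcup.
Qed.

HB.instance Definition _ := isMeasure.Build _ _ _ fin_msum
  fin_msum0 fin_msum_ge0 fin_msum_sigma_additive.

Lemma ge0_integral_fin_msum (f : T -> \bar R) :
  (forall x, 0 <= f x) -> measurable_fun setT f ->
  \int[fin_msum]_x f x = \sum_(i | P i) \int[m i]_x f x.
Proof.
move=> f0 mf; case: (pickP (fun _ : I => true)) => [i0 _|I0]; last first.
  rewrite big_pred0; last by move=> i; have := I0 i.
  rewrite (eq_measure_integral mzero) ?integral_measure_zero// => A _ _.
  by rewrite /= /fin_msum big_pred0// => i; have := I0 i.
pose e := [seq i <- index_enum I | P i].
transitivity (\int[msum (fun k => m (nth i0 e k)) (size e)]_x f x).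
  apply: eq_measure_integral => A _ _.
  by rewrite /= /fin_msum /msum -big_filter (big_nth i0) big_mkord.
rewrite ge0_integral_measure_sum//.
by rewrite -[RHS]big_filter (big_nth i0) big_mkord.
Qed.

End finite_measure_sum.

Definition state (R : realType) : Type := ([set x : R | 0 < x] * nat)%type.

Section state.
Variable R : realType.

HB.instance Definition _ := Topological.copy (state R)
  ([set x : R | 0 < x] * nat)%type.

Lemma one_in_pos : (1 : R) \in [set x : R | 0 < x].
Proof. by apply/mem_set; exact: ltr01. Qed.

HB.instance Definition _ := isPointed.Build (state R) (SigSub one_in_pos, 0%N).

HB.instance Definition _ := @isMeasurable.Build
  (sigma_display (@open (state R))) (state R) <<s @open (state R) >>
  (@sigma_algebra0 _ setT _) (@sigma_algebraC _ _) (@sigma_algebra_bigcup _ setT _).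

End state.

Definition edge (n : nat) : finType := {e : {set 'I_n} | #|e| == 2}.

Definition graph (n : nat) : Type := {set edge n}.

HB.instance Definition _ n := Finite.on (graph n).
HB.instance Definition _ n := isPointed.Build (graph n) (finset.set0 : {set edge n}).
HB.instance Definition _ n := @isMeasurable.Build default_measure_display
  (graph n) discrete_measurable discrete_measurable0
  discrete_measurableC discrete_measurableU.

Section graph.
Variables (n : nat) (G : graph n).

Definition adj : rel 'I_n :=
  [rel u v | [exists e in (G : {set edge n}), val e == [set u; v]%SET]].

Definition components : {set {set 'I_n}} :=
  equivalence_partition (connect adj) [set: 'I_n]%SET.

Definition nb_edges (C : {set 'I_n}) : nat :=
  #|[set e in (G : {set edge n}) | val e \subset C]%SET|.

(* The truncated subtraction is harmless on components: a connected graph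
   satisfies #|C| <= nb_edges C + 1. *)
Definition surplus (C : {set 'I_n}) : nat := (nb_edges C + 1 - #|C|)%N.

Definition component : finType := {C : {set 'I_n} | C \in components}.

Lemma component_gt0 (C : component) : (0 < #|val C|)%N.
Proof.
case: C => C /= /imsetP[x _ ->]; apply/card_gt0P; exists x.
by rewrite inE connect0 andbT.
Qed.

Lemma mass_in_pos (R : realType) (C : component) :
  n%:R `^ (- (2 / 3)) * #|val C|%:R \in [set x : R | 0 < x].
Proof.
apply/mem_set; rewrite /= mulr_gt0 ?ltr0n ?component_gt0//.
rewrite powR_gt0// ltr0n (leq_trans (component_gt0 C))//.
by rewrite -[leqRHS](card_ord n) max_card.
Qed.

Definition atom (R : realType) (C : component) : state R :=
  (SigSub (mass_in_pos R C), surplus (val C)).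

End graph.

Section erdos_renyi.
Variables (R : realType) (n : nat) (p : R).

Definition gnp_pmf (G : graph n) : R :=
  \prod_(e : edge n) (if e \in (G : {set edge n}) then p else 1 - p).

(* For p outside [0, 1] this is the junk value [dirac finset.set0]. *)
Definition gnp (A : set (graph n)) : \bar R :=
  if 0 <= p <= 1 then (\sum_(G | G \in A) (gnp_pmf G)%:E)%E
  else \d_(finset.set0 : graph n) A.

Lemma gnp_pmf_ge0 (G : graph n) : 0 <= p <= 1 -> 0 <= gnp_pmf G.
Proof.
move=> /andP[p0 p1]; apply: prodr_ge0 => e _.
by case: ifP => // _; rewrite subr_ge0.
Qed.

Lemma sum_gnp_pmf : \sum_(G : graph n) gnp_pmf G = 1.
Proof.
rewrite /gnp_pmf.
rewrite -(bigA_distr _ _ (fun=> p) (fun=> 1 - p)) big1// => e _.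
by rewrite /= addrCA subrr addr0.
Qed.

Let gnp0 : gnp set0 = 0%E.
Proof.
rewrite /gnp; case: ifP => _; last by rewrite measure0.
by rewrite big1// => G; rewrite in_set0.
Qed.

Let gnp_ge0 A : (0 <= gnp A)%E.
Proof.
rewrite /gnp; case: ifP => // p01.
by apply: sume_ge0 => G _; rewrite lee_fin gnp_pmf_ge0.
Qed.

Let gnp_sigma_additive : semi_sigma_additive gnp.
Proof.
move=> F mF tF mUF; rewrite /gnp; case: ifP => p01; last first.
  exact: measure_semi_sigma_additive.
pose m (G : graph n) : {measure set (graph n) -> \bar R} :=
  mscale (NngNum (gnp_pmf_ge0 G p01)) \d_G.
have E A : (\sum_(G | G \in A) (gnp_pmf G)%:E)%E = fin_msum xpredT m A.
  rewrite /fin_msum big_mkcond; apply: eq_bigr => G _.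
  by rewrite /m /= /mscale/= diracE; case: (G \in A); rewrite ?mule1 ?mule0.
rewrite E; under eq_fun do under eq_bigr do rewrite E.
exact: measure_semi_sigma_additive.
Qed.

HB.instance Definition _ := isMeasure.Build _ _ _ gnp
  gnp0 gnp_ge0 gnp_sigma_additive.

Let gnp_setT : gnp [set: _] = 1%E.
Proof.
rewrite /gnp; case: ifP => _; last by rewrite diracT.
rewrite -sum_gnp_pmf -sumEFin; apply: eq_bigl => G; exact: in_setT.
Qed.

HB.instance Definition _ :=
  @Measure_isProbability.Build _ _ R gnp gnp_setT.

Lemma ge0_integral_gnp (f : graph n -> \bar R) : (forall G, 0 <= f G)%E ->
  (\int[gnp]_G f G = \sum_(G : graph n) (fine (gnp [set G]))%:E * f G)%E.
Proof.
move=> f0.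
have r0 (G : graph n) : 0 <= fine (gnp [set G]) by exact: fine_ge0.
pose m (G : graph n) : {measure set (graph n) -> \bar R} :=
  mscale (NngNum (r0 G)) \d_G.
transitivity (\int[fin_msum xpredT m]_G f G)%E.
  apply: eq_measure_integral => A _ _.
  rewrite /= /fin_msum /m /= /mscale /=.
  under eq_bigr do rewrite fineK ?fin_num_measure// diracE.
  rewrite /gnp; case: ifP => p01; last first.
    rewrite (bigD1 (finset.set0 : graph n))//= big1 => [|G /negbTE GN0].
      by rewrite !diracE in_set1 eqxx mul1e adde0.
    by rewrite diracE in_set1 eq_sym GN0 mul0e.
  rewrite big_mkcond; apply: eq_bigr => G _.
  rewrite (big_pred1 G) => [|G']; last by rewrite in_set1.
  by case: (G \in A); rewrite ?mule1 ?mule0.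
rewrite ge0_integral_fin_msum//; apply: eq_bigr => G _.
by rewrite /m ge0_integral_mscale//= integral_dirac// diracT mul1e.
Qed.

End erdos_renyi.

Arguments gnp {R} n p A.

Definition p_crit (R : realType) (lambda : R) (n : nat) : R :=
  n%:R^-1 + lambda * n%:R `^ (- (4 / 3)).

Section component_process.
Variables (R : realType) (n : nat).

Definition Xi (G : graph n) : {measure set (state R) -> \bar R} :=
  fin_msum xpredT (fun C : component G =>
    \d_(atom R C) : {measure set (state R) -> \bar R}).

(* Sum over ordered q-tuples of distinct atom indices, i.e. of distinct
   components; distinct components may sit at the same location. *)
Definition factorial_measure (q : nat) (G : graph n) :
    {measure set (q.-tuple (state R)) -> \bar R} :=
  fin_msum (fun t : q.-tuple (component G) => uniq t)
    (fun t => \d_(map_tuple (@atom n G R) t) :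
      {measure set (q.-tuple (state R)) -> \bar R}).

Variable p : R.

Definition factorial_moment (q : nat) (A : set (q.-tuple (state R))) : \bar R :=
  (\int[gnp n p]_G factorial_measure q G A)%E.

Section factorial_moment.
Variable q : nat.
Local Notation alpha := (@factorial_moment q).

Let alpha0 : alpha set0 = 0%E.
Proof.
by rewrite /alpha; under eq_integral do rewrite measure0; rewrite integral0.
Qed.

Let alpha_ge0 A : (0 <= alpha A)%E.
Proof. by apply: integral_ge0 => G _; exact: measure_ge0. Qed.

Let fine_gnp_ge0 (G : graph n) : 0 <= fine (gnp n p [set G]).
Proof. exact: fine_ge0. Qed.

Let m (G : graph n) : {measure set (q.-tuple (state R)) -> \bar R} :=
  mscale (NngNum (fine_gnp_ge0 G)) (factorial_measure q G).

Let alphaE A : alpha A = fin_msum xpredT m A.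
Proof. by rewrite /alpha ge0_integral_gnp. Qed.

Let alpha_sigma_additive : semi_sigma_additive alpha.
Proof.
move=> F mF tF mUF; rewrite alphaE; under eq_fun do under eq_bigr do rewrite alphaE.
exact: measure_semi_sigma_additive.
Qed.

HB.instance Definition _ := isMeasure.Build _ _ _ alpha
  alpha0 alpha_ge0 alpha_sigma_additive.

(* The defining identity of the factorial moment measure. *)
Lemma ge0_integral_factorial_moment (H : q.-tuple (state R) -> \bar R) :
  (forall z, 0 <= H z)%E -> measurable_fun setT H ->
  (\int[alpha]_z H z = \int[gnp n p]_G
     \sum_(t : q.-tuple (component G) | uniq t) H (map_tuple (@atom n G R) t))%E.
Proof.
move=> H0 mH; rewrite (eq_measure_integral (fin_msum xpredT m)); last first.
  by move=> A _ _; exact: alphaE.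
rewrite ge0_integral_fin_msum// ge0_integral_gnp; last first.
  by move=> G; exact: sume_ge0.
apply: eq_bigr => G _; rewrite /m ge0_integral_mscale//=; congr (_ * _)%E.
rewrite ge0_integral_fin_msum//; apply: eq_bigr => t _.
by rewrite integral_dirac// diracT mul1e.
Qed.

End factorial_moment.

(* The product runs over components, so atoms count with multiplicity. *)
Definition pgf (h : state R -> R[i]) : R[i] :=
  complex_integral (gnp n p) (fun G => \prod_(C : component G) (1 + h (atom R C))).

Definition laplace (f : state R -> R[i]) : R[i] :=
  complex_integral (gnp n p) (fun G => cexp (- complex_integral (Xi G) f)).

Definition factorial_term (h : state R -> R[i]) (q : nat) : R[i] :=
  (q`!%:R)^-1 *
  complex_integral (@factorial_moment q) (fun z => \prod_(i < q) h (tnth z i)).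

Definition factorial_partial_sum (h : state R -> R[i]) (Q : nat) : R[i] :=
  \sum_(0 <= q < Q.+1) factorial_term h q.

(* (x)_q = x (x - 1) ... (x - q + 1). *)
Definition falling (x : R) (q : nat) : R := \prod_(i < q) (x - i%:R).

Definition void_probability (B : set (state R)) : R :=
  fine (gnp n p [set G | Xi G B = 0%E]).

Definition mean_falling (B : set (state R)) (q : nat) : R :=
  fine 'E_(gnp n p)[fun G : graph n => falling (fine (Xi G B)) q].

End component_process.

Arguments factorial_moment {R} n p q A.
Arguments pgf {R} n p h.
Arguments laplace {R} n p f.
Arguments factorial_term {R} n p h q.
Arguments factorial_partial_sum {R} n p h Q.
Arguments void_probability {R} n p B.
Arguments mean_falling {R} n p B q.

Section test_functions.
Variable R : realType.

(* [R[i]^o] carries the topology of the complex modulus. *)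
Definition borel_fun (h : state R -> R[i]) : Prop :=
  forall U : set R[i]^o, open U -> measurable (h @^-1` U).

Definition support_in (h : state R -> R[i]) (K : set (state R)) : Prop :=
  closure [set z | h z != 0] `<=` K.

Definition sup_norm_le (h : state R -> R[i]) (T : R) : Prop :=
  forall z, cnorm (h z) <= T.

Definition test_fun (K : set (state R)) (h : state R -> R[i]) : Prop :=
  [/\ borel_fun h, exists T, sup_norm_le h T & support_in h K].

(* One pair (A, d) serves all n, h and Q. *)
Definition uniform_truncation (lambda : R) (n0 : nat) (K : set (state R))
    (T A d : R) : Prop :=
  forall Q : nat,
    (ereal_sup [set x | exists n h,
       [/\ (n0 <= n)%N, test_fun K h, sup_norm_le h T &
         x = (cnorm (pgf n (p_crit lambda n) h -
                factorial_partial_sum n (p_crit lambda n) h Q))%:E]]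
     <= (A * expR (- d * Q%:R ^+ 3))%:E)%E.

End test_functions.

(* Main.v *)
Require Import Defs.
From HB Require Import structures.
From mathcomp Require Import all_boot all_order all_algebra complex.
From mathcomp Require Import all_classical all_reals all_analysis measurable_realfun.
From mathcomp Require Import ring lra zify.

(** Write (x)_q for the falling factorial. Every part of the corollary follows
    from one estimate, [mean_ffact_nb_atoms]: if K is compact, there are C and
    c > 0 with E (Xi_n(K))_q <= C^q exp (- c q^3) for all n and q. The tail bound
    is Markov's inequality for (Xi_n(K))_m. The product of 1 + h over the
    finitely many components expands exactly into sums over ordered tuples of
    distinct components, whose expectations are the integrals against the
    factorial moment measures; the terms with q > Q have total modulus at most
    the sum over q > Q of T^q C^q exp (- c q^3) / q!, which is of order
    exp (- c Q^3). The void probability, the Laplace functional and the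
    exponential moment are special choices of h.

    The estimate. On K the rescaled masses lie in some [a, b] with a > 0, so
    Xi_n(K) is at most the number of components with between a n^{2/3} and
    b n^{2/3} vertices. Given that S is a component of G(u, p), the rest of the
    graph is G(u - |S|, p). Hence the q-th factorial moment is at most the
    product over j < q of bounds for the mean number of such components in
    G(u, p) with u <= n - j a n^{2/3} ([mean_ffact_nb_comps_le]), and it is
    enough that the j-th factor be at most C exp (- c j^2).

    The mean counts. Let f_u(k) = C(u, k) w_k (1 - p)^{k (u - k)} be the mean
    number of components of size k in G(u, p), with w_k the probability that
    G(k, p) is connected. Nothing about w_k is computed. Counting vertices by
    components gives the identity sum_k k f_u(k) = u for every u, with the same
    p and the same w. Let N be just below 1/p. Subtracting the identities for
    N - 1 and N gives sum_k k^3 f_N(k) <= 8 N^2 ([sum_cube_mean_comps]), so that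
    at most a constant mean number of components of G(N, p) have at least
    a n^{2/3} vertices. The ratio f_u(k) / f_N(k) is explicit: for u = N - D it
    is at most exp (- k D^2 / (4 N^2)) ([mean_comps_shrink]), and for u above N
    by O(n^{2/3}) it is bounded when k is at most b n^{2/3}
    ([mean_comps_grow]). With D of order j n^{2/3} and k of order n^{2/3} the
    exponent is of order j^2 ([critical_window]). *)

Set Implicit Arguments.
Unset Strict Implicit.
Unset Printing Implicit Defensive.

Import Order.TTheory GRing.Theory Num.Theory.
Import numFieldNormedType.Exports.
Local Open Scope ring_scope.

(** * Mean component counts for varying numbers of vertices *)

Section binomial_ratio.
Local Open Scope nat_scope.

(** Each factor ratio (u - i) / (N - i) is at most u / N. *)
Lemma bin_ratio_le (u N k : nat) : u <= N -> 'C(u, k) * N ^ k <= 'C(N, k) * u ^ k.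
Proof.
move=> uN; elim: k => [|k IHk]; first by rewrite !bin0 !expn0.
rewrite -(leq_pmul2l (ltn0Sn k)) !mulnA !mul_bin_left !expnS.
have step : (u - k) * N <= (N - k) * u by nia.
have -> : (u - k) * 'C(u, k) * (N * N ^ k) = (u - k) * N * ('C(u, k) * N ^ k).
  by lia.
have -> : (N - k) * 'C(N, k) * (u * u ^ k) = (N - k) * u * ('C(N, k) * u ^ k).
  by lia.
exact: leq_mul.
Qed.

(** Above N the factor ratios (u - i) / (N - i) increase with i, so
    (u - k) / (N - k) bounds them all. *)
Lemma bin_ratio_ge (u N k : nat) : N <= u -> k <= N ->
  'C(u, k) * (N - k) ^ k <= 'C(N, k) * (u - k) ^ k.
Proof.
move=> Nu kN.
suff H j : j <= k -> 'C(u, j) * (N - k) ^ j <= 'C(N, j) * (u - k) ^ j by exact: H.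
elim: j => [|j IHj] jk; first by rewrite !bin0 !expn0.
rewrite -(leq_pmul2l (ltn0Sn j)) !mulnA !mul_bin_left !expnS.
have step : (u - j) * (N - k) <= (N - j) * (u - k) by nia.
have -> : (u - j) * 'C(u, j) * ((N - k) * (N - k) ^ j) =
          (u - j) * (N - k) * ('C(u, j) * (N - k) ^ j) by lia.
have -> : (N - j) * 'C(N, j) * ((u - k) * (u - k) ^ j) =
          (N - j) * (u - k) * ('C(N, j) * (u - k) ^ j) by lia.
by apply: leq_mul => //; exact/IHj/ltnW.
Qed.

End binomial_ratio.

(** Squaring 1 - y/2 <= exp (- y/2) produces the quadratic gain that
    1 - x <= exp (- x) lacks. *)
Lemma one_sub_le_expR {R : realType} (x : R) : 0 <= x <= 1 ->
  1 - x <= expR (- x - x ^+ 2 / 4).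
Proof.
move=> /andP[x0 x1]; set y := x + x ^+ 2 / 4.
have -> : - x - x ^+ 2 / 4 = - (y / 2) + - (y / 2) by rewrite /y; field.
rewrite expRD -expr2.
have h : 1 - y / 2 <= expR (- (y / 2)) by exact: expR_ge1Dx.
have y0 : 0 <= 1 - y / 2 by rewrite /y; nra.
apply: (@le_trans _ _ ((1 - y / 2) ^+ 2)).
  by rewrite /y; nra.
by rewrite ler_pXn2r// ?nnegrE ?expR_ge0.
Qed.

Lemma one_sub_mul_expR_le {R : realType} (x : R) : 0 <= x <= 1 ->
  (1 - x) * expR x <= 1 - x ^+ 2 / 8.
Proof.
move=> x01; have /andP[x0 x1] := x01.
apply: (@le_trans _ _ (expR (- (x ^+ 2 / 4)))).
  have -> : - (x ^+ 2 / 4) = (- x - x ^+ 2 / 4) + x by ring.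
  by rewrite expRD ler_wpM2r ?expR_ge0// one_sub_le_expR.
rewrite expRN; set y := x ^+ 2 / 4.
have y0 : 0 <= y by rewrite /y; nra.
have y1 : y <= 1 by rewrite /y; nra.
have -> : x ^+ 2 / 8 = y / 2 by rewrite /y; field.
have h : 1 + y <= expR y by exact: expR_ge1Dx.
rewrite invf_ple ?posrE ?expR_gt0//; last by nra.
apply: le_trans h; rewrite invf_ple ?posrE//; [|nra|nra].
rewrite -(@ler_pM2r _ (1 + y)); last nra.
rewrite mulVf; last by apply: lt0r_neq0; nra.
nra.
Qed.

Section mean_components.
Variables (R : realType) (q : R) (w : nat -> R).
Hypotheses (q0 : 0 < q) (w0 : forall k, 0 <= w k).

(** When [w k] is the probability that k given vertices span a connected graph,
    this is the mean number of components of size k in G(N, 1 - q): the last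
    factor is the probability that no edge leaves a set of k vertices. *)
Definition mean_comps (N k : nat) : R := 'C(N, k)%:R * w k * q ^+ (k * (N - k)).

Hypothesis mass : forall N, \sum_(k < N.+1) k%:R * mean_comps N k = N%:R.

Lemma mean_comps_ge0 N k : 0 <= mean_comps N k.
Proof. by rewrite /mean_comps !mulr_ge0// exprn_ge0// ltW. Qed.

Lemma mean_comps_pred N k : (0 < N)%N -> (k < N)%N ->
  N%:R * mean_comps N.-1 k = (N - k)%:R * q ^- k * mean_comps N k.
Proof.
move=> N0 kN; rewrite /mean_comps !mulrA -natrM mul_bin_down natrM -!mulrA.
congr (_ * _); rewrite [RHS]mulrC -!mulrA; congr (_ * (_ * _)).
have -> : (k * (N - k) = k * (N.-1 - k) + k)%N by nia.
by rewrite exprD mulfK// expf_neq0// gt_eqF.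
Qed.

(** The difference of the mass identities for N and N - 1: a vertex in a
    component of size k = x N contributes 1 - (1 - x) q^{-k} >= x^2 / 8 to a
    total of 1. In probabilistic terms, the component of a vertex of a barely
    subcritical graph has second moment O(N). *)
Lemma sum_cube_mean_comps N : (0 < N)%N -> q^-1 <= 1 + N%:R^-1 ->
  \sum_(k < N.+1) k%:R ^+ 3 * mean_comps N k <= 8 * N%:R ^+ 2.
Proof.
move=> N0 qN.
have NR : (0 : R) < N%:R by rewrite ltr0n.
(* The index k = N is absent from the identity for N - 1; its weight here is 1. *)
have E : \sum_(k < N.+1) k%:R * mean_comps N k *
    (1 - (1 - k%:R / N%:R) * q ^- k) = 1.
  transitivity (N%:R - N.-1%:R : R); last by rewrite -natrB ?leq_pred// -subn1 subKn.
  rewrite -[in N.-1%:R](mass N.-1) prednK// -[X in X - _](mass N).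
  rewrite big_ord_recr [X in X - _]big_ord_recr/= divff ?gt_eqF// subrr mul0r subr0 mulr1.
  rewrite addrAC; congr (_ + _); rewrite -sumrB; apply: eq_bigr => k _.
  rewrite mulrBr mulr1; congr (_ - _).
  rewrite -mulrA; congr (_ * _); apply: (mulfI (lt0r_neq0 NR)).
  rewrite mean_comps_pred// natrB ?(ltnW (ltn_ord k))//.
  by field; rewrite expf_neq0 ?lt0r_neq0.
have -> : 8 * N%:R ^+ 2 = 8 * N%:R ^+ 2 * \sum_(k < N.+1) k%:R * mean_comps N k *
    (1 - (1 - k%:R / N%:R) * q ^- k) by rewrite E mulr1.
rewrite mulr_sumr; apply: ler_sum => k _.
set x : R := k%:R / N%:R.
have kN : (k <= N)%N by rewrite -ltnS.
have x01 : 0 <= x <= 1.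
  by rewrite divr_ge0//= ler_pdivrMr// mul1r ler_nat.
have h : (1 - x) * q ^- k <= 1 - x ^+ 2 / 8.
  apply: le_trans (one_sub_mul_expR_le x01).
  apply: ler_wpM2l; first by rewrite subr_ge0; case/andP: x01.
  rewrite -exprVn /x expRM_natl.
  apply: lerXn2r; rewrite ?nnegrE ?expR_ge0 ?invr_ge0 ?(ltW q0)//.
  exact: le_trans qN (expR_ge1Dx _).
have -> : k%:R ^+ 3 * mean_comps N k =
    8 * N%:R ^+ 2 * (k%:R * mean_comps N k * (x ^+ 2 / 8)).
  by rewrite /x; field; rewrite gt_eqF.
apply: ler_wpM2l; first by rewrite mulr_ge0// exprn_ge0.
apply: ler_wpM2l; first by rewrite mulr_ge0// mean_comps_ge0.
lra.
Qed.

(** With D = N - u and x = D / N the ratio of the two means is at most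
    ((1 - x) q^{-D})^k, and q^{-D} <= exp x: the first-order terms cancel, and the
    second-order term of 1 - x remains. *)
Lemma mean_comps_shrink u N k : (0 < N)%N -> (u <= N)%N -> q^-1 <= 1 + N%:R^-1 ->
  mean_comps u k <= expR (- (k%:R * ((N - u)%:R / N%:R) ^+ 2 / 4)) * mean_comps N k.
Proof.
move=> N0 uN qN; have NR : (0 : R) < N%:R by rewrite ltr0n.
have [uk|ku] := ltnP u k.
  by rewrite [leLHS]/mean_comps bin_small// !mul0r mulr_ge0 ?expR_ge0 ?mean_comps_ge0.
set x : R := (N - u)%:R / N%:R.
have x01 : 0 <= x <= 1.
  by rewrite divr_ge0//= ler_pdivrMr// mul1r ler_nat leq_subr.
have E1x : u%:R / N%:R = 1 - x.
  by rewrite /x natrB//; field; exact: lt0r_neq0.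
have qD : q ^- (N - u) <= expR x.
  rewrite -exprVn /x expRM_natl.
  apply: lerXn2r; rewrite ?nnegrE ?expR_ge0 ?invr_ge0 ?(ltW q0)//.
  exact: le_trans qN (expR_ge1Dx _).
have base : (u%:R / N%:R) * q ^- (N - u) <= expR (- (x ^+ 2 / 4)).
  rewrite E1x; have -> : - (x ^+ 2 / 4) = (- x - x ^+ 2 / 4) + x by ring.
  rewrite expRD; apply: ler_pM => //.
  - by rewrite subr_ge0; case/andP: x01.
  - by rewrite invr_ge0 exprn_ge0// ltW.
  - exact: one_sub_le_expR.
have basek : ((u%:R / N%:R) * q ^- (N - u)) ^+ k <= expR (- (k%:R * x ^+ 2 / 4)).
  rewrite -[k%:R * _ / _]mulrA -mulrN expRM_natl; apply: lerXn2r; rewrite ?nnegrE ?expR_ge0//.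
  by rewrite mulr_ge0 ?divr_ge0// invr_ge0 exprn_ge0// ltW.
apply: le_trans (ler_wpM2r (mean_comps_ge0 _ _) basek).
have qn0 j : q ^+ j != 0 by rewrite expf_neq0// gt_eqF.
have Eq : q ^+ (k * (u - k)) = q ^- (N - u) ^+ k * q ^+ (k * (N - k)).
  have -> : (k * (N - k) = k * (u - k) + (N - u) * k)%N by nia.
  by rewrite exprD [q ^+ ((N - u) * k)]exprM exprVn [RHS]mulrC mulfK// expf_neq0.
have cb : 'C(u, k)%:R <= (u%:R / N%:R) ^+ k * 'C(N, k)%:R :> R.
  rewrite expr_div_n mulrAC ler_pdivlMr ?exprn_gt0// -!natrX -!natrM ler_nat.
  by rewrite [leqRHS]mulnC bin_ratio_le.
rewrite /mean_comps Eq exprMn.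
have -> : (u%:R / N%:R) ^+ k * q ^- (N - u) ^+ k * ('C(N, k)%:R * w k * q ^+ (k * (N - k)))
  = (u%:R / N%:R) ^+ k * 'C(N, k)%:R * (w k * (q ^- (N - u) ^+ k * q ^+ (k * (N - k)))).
  by ring.
rewrite -[leLHS]mulrA; apply: ler_wpM2r => //.
by rewrite !mulr_ge0// exprn_ge0// ?invr_ge0 ?exprn_ge0// ltW.
Qed.

(** With D = u - N the ratio of the two means is at most
    ((1 + D / (N - k)) q^D)^k. *)
Lemma mean_comps_grow u N k : (N <= u)%N -> (k < N)%N ->
  mean_comps u k <=
  expR (k%:R * ((u - N)%:R * ((N - k)%:R^-1 - (1 - q)))) * mean_comps N k.
Proof.
move=> Nu kN.
have NkR : (0 : R) < (N - k)%:R by rewrite ltr0n subn_gt0.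
rewrite expRM_natl mulrBr expRD.
have b1 : (u - k)%:R / (N - k)%:R <= expR ((u - N)%:R / (N - k)%:R) :> R.
  have -> : (u - k)%:R / (N - k)%:R = 1 + (u - N)%:R / (N - k)%:R :> R.
    have -> : (u - k = (N - k) + (u - N))%N by lia.
    by rewrite natrD mulrDl divff ?lt0r_neq0.
  exact: expR_ge1Dx.
have b2 : q ^+ (u - N) <= expR (- ((u - N)%:R * (1 - q))).
  rewrite -mulrN expRM_natl; apply: lerXn2r; rewrite ?nnegrE ?expR_ge0 ?(ltW q0)//.
  by have := expR_ge1Dx (- (1 - q)); rewrite opprB addrC subrK.
have b12 : ((u - k)%:R / (N - k)%:R * q ^+ (u - N)) ^+ k <=
    (expR ((u - N)%:R / (N - k)%:R) * expR (- ((u - N)%:R * (1 - q)))) ^+ k.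
  apply: lerXn2r; rewrite ?nnegrE ?mulr_ge0 ?expR_ge0 ?invr_ge0 ?exprn_ge0 ?(ltW q0)//.
  by apply: ler_pM => //; rewrite ?divr_ge0 ?exprn_ge0 ?(ltW q0).
apply: le_trans (ler_wpM2r (mean_comps_ge0 _ _) b12).
have cb : 'C(u, k)%:R <= ((u - k)%:R / (N - k)%:R) ^+ k * 'C(N, k)%:R :> R.
  rewrite expr_div_n mulrAC ler_pdivlMr ?exprn_gt0// -!natrX -!natrM ler_nat.
  by rewrite [leqRHS]mulnC bin_ratio_ge// ltnW.
have Eq : q ^+ (k * (u - k)) = q ^+ (u - N) ^+ k * q ^+ (k * (N - k)).
  by rewrite -exprM -exprD; congr (_ ^+ _); nia.
rewrite /mean_comps Eq exprMn.
set a := ((u - k)%:R / (N - k)%:R) ^+ k.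
have -> : a * q ^+ (u - N) ^+ k * ('C(N, k)%:R * w k * q ^+ (k * (N - k)))
  = a * 'C(N, k)%:R * (w k * (q ^+ (u - N) ^+ k * q ^+ (k * (N - k)))) by ring.
rewrite -[leLHS]mulrA; apply: ler_wpM2r => //.
by rewrite !mulr_ge0// exprn_ge0// ?exprn_ge0// ltW.
Qed.

(** Markov's inequality for the third moment in [sum_cube_mean_comps]. *)
Lemma sum_window_le (I : pred nat) (l c : R) N u :
  (0 < N)%N -> q^-1 <= 1 + N%:R^-1 -> 0 < l -> 0 <= c ->
  (forall k, I k -> l <= k%:R) ->
  (forall k, I k -> mean_comps u k <= c * mean_comps N k) ->
  \sum_(k < u.+1 | I k) mean_comps u k <= c * (8 * N%:R ^+ 2 / l ^+ 3).
Proof.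
move=> N0 qN l0 c0 Il Iu.
apply: (@le_trans _ _ (c * \sum_(k < (u + N).+1) (k%:R ^+ 3 * mean_comps N k / l ^+ 3))).
  rewrite mulr_sumr (big_ord_widen_cond (u + N).+1 I (mean_comps u)) ?ltnS ?leq_addr//.
  rewrite big_mkcond; apply: ler_sum => k _.
  case: ifP => [/andP[Ik _]|_]; last first.
    by rewrite !mulr_ge0// ?invr_ge0 ?exprn_ge0 ?mean_comps_ge0// ltW.
  apply: le_trans (Iu _ Ik) _; apply: ler_wpM2l => //.
  rewrite ler_pdivlMr ?exprn_gt0// mulrC; apply: ler_wpM2r; first exact: mean_comps_ge0.
  by apply: lerXn2r; rewrite ?nnegrE ?(ltW l0)//; exact: Il.
apply: ler_wpM2l => //; rewrite -mulr_suml ler_wpM2r ?invr_ge0 ?exprn_ge0 ?(ltW l0)//.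
apply: le_trans (sum_cube_mean_comps N0 qN).
rewrite le_eqVlt; apply/orP; left; apply/eqP; symmetry.
rewrite (big_ord_widen (u + N).+1 (fun k => k%:R ^+ 3 * mean_comps N k)) ?ltnS ?leq_addl//.
rewrite [LHS]big_mkcond; apply: eq_bigr => k _; case: ltnP => // Nk.
by rewrite /mean_comps bin_small// !mul0r mulr0.
Qed.

End mean_components.

(** For n = s^3 vertices and p in the critical window, a number N of vertices
    at which the graph is barely subcritical differs from n by O(n^{2/3}). *)
Lemma reference_size {R : realType} (lambda L s p : R) :
  `|lambda| + 1 <= L -> 4 * L <= s -> p = s ^- 3 + lambda * s ^- 4 ->
  exists N : nat, [/\ s ^+ 3 - L * s ^+ 2 <= N%:R <= 2 * s ^+ 3, 0 < 1 - p,
    (1 - p)^-1 <= 1 + N%:R^-1 & 1 < (N%:R + 2) * p].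
Proof.
move=> lamL sL pE.
have L1 : 1 <= L by apply: le_trans lamL; rewrite lerDr.
have /andP[lam1 lam2] : - (L - 1) <= lambda <= L - 1 by rewrite -ler_norml lerBrDr.
have s4 : 4 <= s by lra.
have s0 : 0 < s by lra.
pose v := s^-1.
have v0 : 0 < v by rewrite invr_gt0.
have vs : v * s = 1 by rewrite mulVf ?gt_eqF.
have s3v : s ^+ 3 * v ^+ 3 = 1 by rewrite -exprMn mulrC vs expr1n.
have pv : p = v ^+ 3 * (1 + lambda * v) by rewrite pE /v; field; exact: lt0r_neq0.
have Lv : L * v <= 1/4.
  have : 4 * L * v <= v * s by rewrite [v * s]mulrC ler_wpM2r// ltW.
  by rewrite vs; lra.
have /andP[lv1 lv2] : - (1/4) <= lambda * v <= 1/4 by apply/andP; split; nra.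
have v30 : 0 < v ^+ 3 by rewrite exprn_gt0.
have v3 : v ^+ 3 <= 1/64.
  have v4 : v <= 1/4 by nra.
  by rewrite (_ : v ^+ 3 = v * v * v); [nra|ring].
have p0 : 0 < p by rewrite pv mulr_gt0//; lra.
have plo : v ^+ 3 / 2 <= p by rewrite pv; apply: ler_wpM2l; [exact: ltW|lra].
have p12 : p <= 1/2 by rewrite pv; nra.
(* N <= (1 - p) / p is what (1 - p)^-1 <= 1 + 1/N requires; then N + 2 > 1/p. *)
pose N := Num.truncn ((1 - p) / p).
have /andP[Nle Nlt] : N%:R <= (1 - p) / p < N.+1%:R.
  by apply: truncn_itv; rewrite divr_ge0// ?ltW//; lra.
have Np : N%:R * p <= 1 - p by rewrite -ler_pdivlMr.
have Np2 : 1 < (N%:R + 2) * p.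
  by move: Nlt; rewrite ltr_pdivrMr// -natr1; nra.
have q0 : 0 < 1 - p by lra.
clear pE Nlt Nle.
have Nlo : s ^+ 3 - L * s ^+ 2 <= N%:R.
  have h : (s ^+ 3 - (L - 1) * s ^+ 2) * p <= 1.
    have -> : (s ^+ 3 - (L - 1) * s ^+ 2) * p =
       (s ^+ 3 * v ^+ 3) * (1 - (L - 1) * v) * (1 + lambda * v).
      by rewrite pv /v; field; exact: lt0r_neq0.
    have yx : lambda * v <= (L - 1) * v by rewrite ler_wpM2r// ltW.
    have x0 : 0 <= (L - 1) * v by rewrite mulr_ge0 ?(ltW v0)// subr_ge0.
    by rewrite s3v mul1r; clear -yx x0 lv1 Lv v0; nra.
  have : s ^+ 3 - (L - 1) * s ^+ 2 <= N%:R + 2.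
    by rewrite -(ler_pM2r p0); apply: le_trans h _; exact: ltW.
  by clear -s4; nra.
have s30 : 0 < s ^+ 3 by rewrite exprn_gt0.
have Nhi : N%:R <= 2 * s ^+ 3.
  have h1 : N%:R * (v ^+ 3 / 2) <= 1.
    by apply: le_trans (ler_wpM2l (ler0n _ N) plo) _; lra.
  have := ler_wpM2r (ltW s30) h1.
  rewrite (_ : N%:R * _ * s ^+ 3 = N%:R / 2 * (s ^+ 3 * v ^+ 3)); last by ring.
  by rewrite s3v; lra.
exists N; split=> //; first by rewrite Nlo.
have NR0 : (0 : R) < N%:R.
  have s2 : 0 < s ^+ 2 by rewrite exprn_gt0.
  by apply: lt_le_trans Nlo; rewrite [s ^+ 3]exprS -mulrBl mulr_gt0//; lra.
have -> : (1 - p)^-1 = 1 + p / (1 - p) by field; exact: lt0r_neq0.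
by rewrite lerD2l ler_pdivrMr// ler_pdivlMl.
Qed.

(** As long as j a <= L, the gain of order j^2 that is claimed for the j-th
    component is at most a constant, which can be given away. *)
Lemma rate_early {R : realType} (a L j : R) : 0 < a -> 0 <= L -> 0 <= j ->
  j * a <= L -> a ^+ 3 / 32 * (j + 1) ^+ 2 <= a * (a + L) ^+ 2 / 16.
Proof.
move=> a0 L0 j0 jL.
have sq : (j * a + a) ^+ 2 <= (a + L) ^+ 2.
  by apply: lerXn2r; rewrite ?nnegrE ?addr_ge0 ?mulr_ge0 ?(ltW a0)//; lra.
have -> : a ^+ 3 / 32 * (j + 1) ^+ 2 = a * (j * a + a) ^+ 2 / 32 by field.
have := ler_wpM2l (ltW a0) sq.
have : 0 <= a * (a + L) ^+ 2 by rewrite mulr_ge0 ?sqr_ge0// ltW.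
by lra.
Qed.

(** The exponent of [mean_comps_shrink] in the critical window: after j
    components with at least a s^2 vertices, the deficit D with respect to N is
    at least (j a - L) s^2. *)
Lemma rate_shrink {R : realType} (a L s j N D k : R) :
  0 < a -> 0 <= L -> 0 < s -> 0 <= j -> 0 < N -> N <= 2 * s ^+ 3 ->
  0 <= D -> (j * a - L) * s ^+ 2 <= D -> a * s ^+ 2 <= k ->
  a ^+ 3 / 32 * (j + 1) ^+ 2 <= a * (a + L) ^+ 2 / 16 + k * (D / N) ^+ 2 / 4.
Proof.
move=> a0 L0 s0 j0 N0 Ns D0 jD ak.
have k0 : 0 <= k by apply: le_trans ak; rewrite mulr_ge0 ?sqr_ge0// ltW.
have [jL|jL] := leP (j * a) L.
  apply: le_trans (rate_early a0 L0 j0 jL) _; rewrite lerDl.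
  by rewrite divr_ge0// mulr_ge0// sqr_ge0.
have jL0 : 0 <= j * a - L by rewrite subr_ge0 ltW.
have x : (j * a - L) / (2 * s) <= D / N.
  rewrite ler_pdivlMr//; apply: le_trans jD.
  rewrite (_ : (j * a - L) * s ^+ 2 = (j * a - L) / (2 * s) * (2 * s ^+ 3)).
    by apply: ler_wpM2l => //; rewrite divr_ge0// mulr_ge0// ltW.
  by field; exact: lt0r_neq0.
have x2 : ((j * a - L) / (2 * s)) ^+ 2 <= (D / N) ^+ 2.
  apply: lerXn2r; rewrite ?nnegrE ?divr_ge0 ?(ltW N0)//.
  by rewrite mulr_ge0// ltW.
have kx : a * (j * a - L) ^+ 2 / 4 <= k * (D / N) ^+ 2.
  rewrite (_ : a * (j * a - L) ^+ 2 / 4 = a * s ^+ 2 * ((j * a - L) / (2 * s)) ^+ 2).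
    apply: ler_pM => //; last exact: sqr_ge0.
    by rewrite mulr_ge0 ?sqr_ge0// ltW.
  by field; exact: lt0r_neq0.
(* (x - y)^2 >= x^2/2 - y^2 with x = a (j + 1) and y = a + L *)
have sq : 0 <= a * (j * a + a - 2 * (a + L)) ^+ 2 by rewrite mulr_ge0 ?sqr_ge0// ltW.
by clear -kx sq; lra.
Qed.

(** The exponent of [mean_comps_grow] in the critical window: p exceeds
    1 / (N + 2), so 1 / (N - k) - p is of order k / N^2, that is s^{-4}, against
    k D of order s^4. *)
Lemma rate_grow {R : realType} (b L s p N D k : R) :
  0 < b -> 0 < L -> 2 <= s -> s ^+ 3 / 2 <= N -> s ^+ 3 / 4 <= N - k ->
  1 < (N + 2) * p -> 0 <= k <= b * s ^+ 2 -> 0 <= D <= L * s ^+ 2 ->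
  k * (D * ((N - k)^-1 - p)) <= 8 * b * L * (b + 1).
Proof.
move=> b0 L0 s2 Ns Nks Np /andP[k0 kb] /andP[D0 DL].
have s0 : 0 < s by lra.
have s30 : 0 < s ^+ 3 by rewrite exprn_gt0.
have s20 : 0 < s ^+ 2 by rewrite exprn_gt0.
have Nk0 : 0 < N - k by apply: lt_le_trans Nks; lra.
have N20 : 0 < N + 2 by lra.
have AB0 : 0 < (N - k) * (N + 2) by rewrite mulr_gt0.
have k2 : k + 2 <= (b + 1) * s ^+ 2 by clear -s2 kb; nra.
have gap : (N - k)^-1 - p <= (b + 1) * s ^+ 2 * (8 / s ^+ 6).
  have pN : (N + 2)^-1 <= p by rewrite -div1r ler_pdivrMr// mulrC ltW.
  apply: (@le_trans _ _ ((N - k)^-1 - (N + 2)^-1)); first by rewrite lerB.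
  have -> : (N - k)^-1 - (N + 2)^-1 = (k + 2) * ((N - k) * (N + 2))^-1.
    by field; rewrite !lt0r_neq0.
  apply: ler_pM => //; [by rewrite addr_ge0|by rewrite invr_ge0 ltW|].
  have -> : 8 / s ^+ 6 = (s ^+ 3 / 4 * (s ^+ 3 / 2))^-1.
    by field; exact: lt0r_neq0.
  rewrite lef_pV2 ?posrE//; last by rewrite mulr_gt0//; lra.
  by apply: ler_pM; lra.
have g0 : 0 <= (b + 1) * s ^+ 2 * (8 / s ^+ 6).
  by rewrite !mulr_ge0 ?invr_ge0 ?exprn_ge0 ?(ltW s20) ?(ltW s0)//; lra.
have -> : 8 * b * L * (b + 1) =
    b * s ^+ 2 * (L * s ^+ 2 * ((b + 1) * s ^+ 2 * (8 / s ^+ 6))).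
  by field; exact: lt0r_neq0.
apply: (@le_trans _ _ (k * (D * ((b + 1) * s ^+ 2 * (8 / s ^+ 6))))).
  by rewrite !ler_wpM2l.
by apply: ler_pM => //; [rewrite mulr_ge0|apply: ler_wpM2r].
Qed.

Definition window_rate {R : realType} (a : R) : R := a ^+ 3 / 32.

(** The first term pays for the indices j with j a <= L, the second one for
    sizes above the reference size. *)
Definition window_cost {R : realType} (a b L : R) : R :=
  a * (a + L) ^+ 2 / 16 + 8 * b * L * (b + 1).

(** Here s stands for n^{1/3}, and u for a number of vertices that may be left
    once j components with at least a n^{2/3} vertices are removed. *)
Lemma critical_window {R : realType} (lambda a b L s p : R) (n : nat) (w : nat -> R)
    (I : pred nat) (j u : nat) :
  0 < a -> 0 < b -> `|lambda| + 1 <= L ->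
  4 * (L + b) <= s -> s ^+ 3 = n%:R -> p = s ^- 3 + lambda * s ^- 4 ->
  (forall k, 0 <= w k) ->
  (forall N, \sum_(k < N.+1) k%:R * mean_comps (1 - p) w N k = N%:R) ->
  (forall k, I k -> a * s ^+ 2 <= k%:R <= b * s ^+ 2) ->
  u%:R + j%:R * (a * s ^+ 2) <= n%:R ->
  \sum_(k < u.+1 | I k) mean_comps (1 - p) w u k <=
    32 * expR (window_cost a b L) / a ^+ 3 * expR (- window_rate a * j.+1%:R ^+ 2).
Proof.
move=> a0 b0 lamL sbig sn pE w0 mass Iab ujn.
have L1 : 1 <= L by apply: le_trans lamL; rewrite lerDr.
have sL : 4 * L <= s by apply: le_trans sbig; rewrite ler_pM2l// lerDl ltW.
have [N [/andP[Nlo Nhi] q0 qN Np2]] := reference_size lamL sL pE.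
have s4 : 4 <= s by clear -L1 sL; lra.
have s0 : 0 < s by clear -s4; lra.
have s20 : 0 < s ^+ 2 by rewrite exprn_gt0.
have Ls : 4 * L * s ^+ 2 <= s ^+ 3 by rewrite [s ^+ 3]exprS ler_wpM2r// ltW.
have bs : 4 * b * s ^+ 2 <= s ^+ 3.
  rewrite [s ^+ 3]exprS ler_wpM2r ?(ltW s20)//.
  by apply: le_trans sbig; rewrite ler_pM2l// lerDr; lra.
have s30 : 0 < s ^+ 3 by rewrite exprn_gt0.
have Nlo2 : s ^+ 3 / 2 <= N%:R by clear -Nlo Ls s30; lra.
have NR0 : (0 : R) < N%:R by clear -Nlo2 s30; lra.
have N0 : (0 < N)%N by rewrite -(ltr0n R).
have c0 : 0 <= 8 * b * L * (b + 1).
  by rewrite !mulr_ge0 ?addr_ge0 ?(ltW b0)//; lra.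
have e0 : 0 <= a * (a + L) ^+ 2 / 16 by rewrite divr_ge0// mulr_ge0 ?sqr_ge0// ltW.
apply: (@le_trans _ _ (expR (window_cost a b L) * expR (- window_rate a * j.+1%:R ^+ 2) *
                       (8 * N%:R ^+ 2 / (a * s ^+ 2) ^+ 3))); last first.
  have -> : 32 * expR (window_cost a b L) / a ^+ 3 * expR (- window_rate a * j.+1%:R ^+ 2) =
    expR (window_cost a b L) * expR (- window_rate a * j.+1%:R ^+ 2) * (32 / a ^+ 3) by ring.
  apply: ler_wpM2l; first by rewrite mulr_ge0 ?expR_ge0.
  rewrite ler_pdivrMr; last by rewrite exprn_gt0// mulr_gt0.
  have -> : 32 / a ^+ 3 * (a * s ^+ 2) ^+ 3 = 8 * (2 * s ^+ 3) ^+ 2.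
    by field; exact: lt0r_neq0.
  by rewrite ler_pM2l//; apply: lerXn2r; rewrite ?nnegrE// mulr_ge0// ltW.
apply: (sum_window_le q0 w0 mass (l := a * s ^+ 2)) => //.
- by rewrite mulr_gt0.
- by move=> k /Iab/andP[].
move=> k /Iab/andP[ka kb]; rewrite -expRD mulNr /window_rate -[j.+1%:R]natr1.
have jR : (0 : R) <= j%:R by [].
have L0 : 0 <= L by clear -L1; lra.
have [uN|Nu] := leqP u N.
  apply: le_trans (mean_comps_shrink q0 w0 k N0 uN qN) _.
  apply: ler_wpM2r; first exact: mean_comps_ge0.
  rewrite ler_expR.
  have D : (j%:R * a - L) * s ^+ 2 <= (N - u)%:R by rewrite natrB//; clear -Nlo ujn sn; lra.
  have := rate_shrink a0 L0 s0 jR NR0 Nhi (ler0n _ _) D ka.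
  by rewrite /window_cost; clear -c0; lra.
have NuR : N%:R <= u%:R :> R by rewrite ler_nat ltnW.
have jL : j%:R * a <= L.
  have : 0 <= (L - j%:R * a) * s ^+ 2 by clear -NuR Nlo ujn sn; lra.
  by rewrite pmulr_lge0// subr_ge0.
have kN' : k%:R < N%:R :> R by clear -kb bs Nlo2 s30; lra.
have kN : (k < N)%N by rewrite -(ltr_nat R).
apply: le_trans (mean_comps_grow q0 w0 (ltnW Nu) kN) _.
apply: ler_wpM2r; first exact: mean_comps_ge0.
rewrite ler_expR subKr (natrB _ (ltnW kN)).
apply: (@le_trans _ _ (8 * b * L * (b + 1))); last first.
  by have := rate_early a0 L0 jR jL; rewrite /window_cost; clear; lra.
apply: (@rate_grow R b L s) => //.
- by clear -L1; lra.
- by clear -s4; lra.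
- by clear -Nlo2 kb bs; lra.
- by rewrite ler0n.
rewrite ler0n natrB ?(ltnW Nu)//=.
have : 0 <= j%:R * a * s ^+ 2 by rewrite !mulr_ge0 ?(ltW a0)// ltW.
by clear -Nlo ujn sn; lra.
Qed.

(** * Components of a graph, by cuts *)

Section Cuts.
Import mathcomp.boot.fingraph mathcomp.boot.fintype mathcomp.boot.finset.
Local Open Scope set_scope.
Local Open Scope nat_scope.
Variable n : nat.
Implicit Types (G : {set edge n}) (A S T U : {set 'I_n}) (e : edge n).

(** For S inside U: no edge of G joins S to the rest of U. It is stated by
    inclusions of whole edges, which makes its closure properties set algebra. *)
Definition detached U S G : bool :=
  [forall e in G, (val e \subset U) ==> (val e \subset S) || (val e \subset U :\: S)].

(** Connectedness by cuts instead of paths: it visibly depends only on the edges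
    inside S, and a component is then a minimal nonempty detached set. *)
Definition conn_set S G : bool :=
  (S != set0) && [forall A : {set 'I_n}, (A \proper S) ==> (A != set0) ==> ~~ detached S A G].

Definition is_comp U G S : bool :=
  [&& S \subset U, detached U S G & conn_set S G].

Lemma detachedP U S G : reflect
  (forall e, e \in G -> val e \subset U -> (val e \subset S) || (val e \subset U :\: S))
  (detached U S G).
Proof.
apply: (iffP forall_inP) => H e eG; last by apply/implyP; exact: H.
by move/implyP: (H e eG).
Qed.

Lemma detached_full U G : detached U U G.
Proof. by apply/detachedP => e _ ->. Qed.

Lemma detachedC U S G : S \subset U -> detached U S G -> detached U (U :\: S) G.
Proof.
move=> /setIidPr SU /detachedP H; apply/detachedP => e eG eU.
by rewrite setDDr setDv set0U SU orbC; exact: H.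
Qed.

Lemma detachedI U S T G :
  detached U S G -> detached U T G -> detached U (S :&: T) G.
Proof.
move=> /detachedP HS /detachedP HT; apply/detachedP => e eG eU.
rewrite subsetI setDIr; have /orP[->|h] := HS e eG eU; last first.
  by rewrite (subset_trans h (subsetUl _ _)) orbT.
have /orP[->//|h] := HT e eG eU.
by rewrite (subset_trans h (subsetUr _ _)) orbT.
Qed.

Lemma detached_trans U S T G : S \subset U -> T \subset S ->
  detached U S G -> detached S T G -> detached U T G.
Proof.
move=> SU TS /detachedP HS /detachedP HT; apply/detachedP => e eG eU.
have /orP[h|h] := HS e eG eU.
  have /orP[->//|h'] := HT e eG h.
  by rewrite (subset_trans h' (setSD _ SU)) orbT.
by rewrite (subset_trans h (setDS _ TS)) orbT.
Qed.

Lemma detachedS U S T G : S \subset U -> 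
  detached U T G -> detached S T G.
Proof.
move=> SU /detachedP HT; apply/detachedP => e eG eS.
have /orP[->//|h] := HT e eG (subset_trans eS SU).
by move: h; rewrite !subsetD eS => /andP[_ ->]; rewrite orbT.
Qed.

Lemma conn_set_sub S T G : conn_set S G -> detached S (S :&: T) G ->
  S :&: T != set0 -> S \subset T.
Proof.
move=> /andP[_ /forallP/(_ (S :&: T))/implyP H] sep n0.
apply/setIidPl/eqP; apply: contraTT sep => ST.
by move: H; rewrite properEneq ST subsetIl n0; exact.
Qed.

Lemma is_comp_sub U S T G : is_comp U G S -> is_comp U G T -> S :&: T != set0 ->
  S \subset T.
Proof.
move=> /and3P[SU sepS cS] /and3P[TU sepT cT].
by apply: conn_set_sub cS _; apply: (detachedS SU); exact: detachedI.
Qed.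

Lemma is_comp_eq U S T G : is_comp U G S -> is_comp U G T -> S :&: T != set0 -> S = T.
Proof.
move=> cS cT ST; apply/eqP; rewrite eqEsubset (is_comp_sub cS cT)//.
by rewrite (is_comp_sub cT cS)// setIC.
Qed.

(** A smallest detached set containing x is connected: a cut would leave a
    smaller detached set on the side of x. *)
Lemma is_comp_cover U G x : x \in U -> exists2 S, is_comp U G S & x \in S.
Proof.
move=> xU; pose P := [pred S : {set 'I_n} | [&& S \subset U, x \in S & detached U S G]].
have PU : P U by rewrite /P /= subxx xU detached_full.
have [S /and3P[SU xS sepS] Smin] := arg_minnP (fun S : {set 'I_n} => #|S|) PU.
exists S => //; rewrite /is_comp SU sepS/=; apply/andP; split.
  by apply/set0Pn; exists x.
apply/forallP => A; apply/implyP => AS; apply/implyP => A0; apply/negP => sepA.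
have AS' := proper_sub AS.
have key (B : {set _}) : B \subset S -> x \in B -> detached S B G -> #|S| <= #|B|.
  move=> BS xB sepB; apply: Smin; rewrite /= xB (subset_trans BS SU)/=.
  exact: detached_trans sepB.
have [xA|xA] := boolP (x \in A).
  by have := key A AS' xA sepA; rewrite leqNgt (proper_card AS).
have := key (S :\: A); rewrite subsetDl inE xA xS detachedC// => /(_ isT isT isT).
have /setIidPr SA := AS'.
rewrite cardsD SA; have := subset_leq_card AS'.
by move: A0; rewrite -card_gt0; lia.
Qed.

Definition comps U G : {set {set 'I_n}} := [set S | is_comp U G S].

Lemma sum_card_comps U G : \sum_(S in comps U G) #|S| = #|U|.
Proof.
have tI : trivIset (comps U G).
  apply/trivIsetP => S T; rewrite !inE => cS cT; apply: contraNT => d.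
  by apply/eqP; apply: (is_comp_eq cS cT); rewrite setI_eq0.
have cov : cover (comps U G) = U.
  apply/setP => x; apply/bigcupP/idP => [[S]|/(is_comp_cover G)[S cS xS]].
    by rewrite inE => /and3P[/subsetP SU _ _] /SU.
  by exists S => //; rewrite inE.
by move: tI; rewrite /trivIset cov => /eqP.
Qed.

Lemma is_comp_neq0 U G S : is_comp U G S -> S != set0.
Proof. by case/and3P=> _ _ /andP[]. Qed.

(** The remaining components are those of the graph induced on the remaining
    vertices; the recursion for factorial moments rests on this. *)
Lemma comps_remove U G S : is_comp U G S ->
  S \notin comps (U :\: S) G /\ comps U G = S |: comps (U :\: S) G.
Proof.
move=> cS; have S0 := is_comp_neq0 cS; have /and3P[SU sepS connS] := cS.
have DU : U :\: S \subset U := subsetDl _ _.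
split.
  apply/negP; rewrite inE => /and3P[+ _ _].
  by rewrite subsetD -setI_eq0 setIid (negPf S0) andbF.
apply/setP => T; rewrite in_setU1 !inE; apply/idP/orP => [cT|[/eqP->//|]].
  have [->|neqTS] := eqVneq T S; first by left.
  right; have /and3P[TU sepT connT] := cT.
  rewrite /is_comp connT (detachedS DU sepT) subsetD TU !andbT/= -setI_eq0.
  by apply: contraNT neqTS => d; apply/eqP; exact: is_comp_eq cT cS d.
case/and3P=> TD sepT connT; rewrite /is_comp connT (subset_trans TD DU) andbT/=.
exact: detached_trans DU TD (detachedC SU sepS) sepT.
Qed.

Lemma adjP G x y : reflect (exists2 e : edge n, e \in G & val e = [set x; y]) (adj G x y).
Proof.
apply: (iffP existsP) => [[e /andP[eG /eqP E]]|[e eG E]]; first by exists e.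
by exists e; rewrite eG E eqxx.
Qed.

Lemma adj_sym G : symmetric (adj G).
Proof. by move=> x y; rewrite /adj /= setUC. Qed.

Lemma edgeP e : exists x y, x != y /\ val e = [set x; y].
Proof. by have /cards2P[x [y [xy E]]] := valP e; exists x, y. Qed.

Lemma adj_detached S A G x y : detached S A G -> x \in A -> adj G x y ->
  x \in S -> y \in S -> y \in A.
Proof.
move=> /detachedP sep xA /adjP[e eG E] xS yS.
have eS : val e \subset S by rewrite E subUset !sub1set xS.
have /orP[] := sep e eG eS; rewrite E subUset !sub1set; first by case/andP.
by rewrite !inE xA.
Qed.

(** A detached part of a path class is closed under adjacency, hence is empty or
    the whole class. *)
Lemma connect_is_comp G x : is_comp setT G [set y | connect (adj G) x y].
Proof.
have symc : connect_sym (adj G) by apply: sym_connect_sym; exact: adj_sym.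
set S := [set y | _]; apply/and3P; split; first exact: subsetT.
  apply/detachedP => e eG _; have [u [v [_ E]]] := edgeP e.
  have uv : connect (adj G) u v by apply: connect1; apply/adjP; exists e.
  rewrite E !subUset !sub1set !inE !andbT.
  have -> : connect (adj G) x v = connect (adj G) x u.
    by rewrite !(symc x) (same_connect symc uv).
  by case: connect.
apply/andP; split; first by apply/set0Pn; exists x; rewrite inE connect0.
apply/forallP => A; apply/implyP => /properP[AS [b bS bA]].
apply/implyP => /set0Pn[a aA]; apply/negP => sep.
have aS := subsetP AS _ aA.
have cl : closed (adj G) (mem A).
  apply: intro_closed => // u v uv uA; have uS := subsetP AS _ uA.
  apply: (adj_detached sep uA uv uS).
  by move: uS; rewrite !inE => uS; apply: connect_trans uS (connect1 uv).
have ab : connect (adj G) a b.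
  by move: aS bS; rewrite !inE symc => aS bS; exact: connect_trans aS bS.
have abA : (a \in A) = (b \in A) := closed_connect cl ab.
by rewrite -abA aA in bA.
Qed.

Lemma componentsE G : components G = comps setT G.
Proof.
have symc : connect_sym (adj G) by apply: sym_connect_sym; exact: adj_sym.
apply/setP => S; rewrite inE; apply/imsetP/idP => [[x _ ->]|cS].
  have := connect_is_comp G x; congr (is_comp _ _ _).
  by apply/setP => y; rewrite !inE.
have /set0Pn[x xS] := is_comp_neq0 cS.
exists x => //; apply: (@is_comp_eq setT S _ G cS).
  have := connect_is_comp G x; congr (is_comp _ _ _).
  by apply/setP => y; rewrite !inE.
by apply/set0Pn; exists x; rewrite !inE xS connect0.
Qed.

Definition edges_in S : {set edge n} := [set e : edge n | val e \subset S].

(** The edges between S and the rest of U, for S inside U; as a difference it is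
    disjoint from the two sets of inner edges by construction. *)
Definition edges_across U S : {set edge n} := edges_in U :\: (edges_in S :|: edges_in (U :\: S)).

Lemma detachedE U S G : detached U S G = [disjoint G & edges_across U S].
Proof.
rewrite disjoint_subset; apply/detachedP/subsetP => H e eG.
  rewrite !inE negb_and negbK; have := H e eG.
  by case: (val e \subset U) => [->//|_]; rewrite orbT.
by move=> eU; have := H e eG; rewrite !inE eU andbT negbK.
Qed.

Lemma card_edges_across U S : S \subset U -> #|edges_across U S| = #|S| * #|U :\: S|.
Proof.
move=> SU; rewrite -cardsX -(card_imset _ val_inj).
have inj : {in setX S (U :\: S) &, injective (fun u : 'I_n * 'I_n => [set u.1; u.2])}.
  move=> [x y] [x' y']; rewrite !in_setX !inE/= => /and3P[xS yS _] /and3P[x'S y'S _] E.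
  have H z : (z \in [set x; y]) = (z \in [set x'; y']) by rewrite E.
  have xx' : x = x'.
    have := H x; rewrite !inE eqxx/= => /esym/orP[/eqP//|/eqP xy'].
    by rewrite -xy' xS in y'S.
  congr (_, _) => //.
  have := H y; rewrite !inE eqxx orbT => /esym/orP[/eqP yx'|/eqP//].
  by rewrite yx' x'S in yS.
rewrite -(card_in_imset inj); apply: eq_card => E; apply/imsetP/imsetP.
  move=> [e + ->]; rewrite !inE => /andP[+ eU].
  have [x [y [xy E']]] := edgeP e; move: eU; rewrite E' !subUset !sub1set.
  move=> /andP[xU yU]; rewrite !inE xU yU !andbT.
  have [xS|xS] := boolP (x \in S); have [yS|yS] := boolP (y \in S) => //= _.
    by exists (x, y) => //; rewrite !inE/= xS yS.
  by exists (y, x); rewrite ?inE/= ?xS ?yS// setUC.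
move=> [[x y]]; rewrite !inE/= => /and3P[xS yS yU] ->.
have xU := subsetP SU _ xS.
have xy : x != y by apply: contraTneq xS => ->.
have c2 : #|[set x; y]| == 2 by rewrite cards2 xy.
exists (Sub [set x; y] c2 : edge n); last by [].
by rewrite !inE !subUset !sub1set !inE xU yU xS (negPf yS).
Qed.

Lemma edges_across_in U S : [disjoint edges_across U S & edges_in S].
Proof.
rewrite disjoint_subset; apply/subsetP => e; rewrite !inE negb_or.
by case/andP => /andP[].
Qed.

Lemma edges_across_inD U S : [disjoint edges_across U S & edges_in (U :\: S)].
Proof.
rewrite disjoint_subset; apply/subsetP => e; rewrite !inE negb_or.
by case/andP => /andP[].
Qed.

Lemma edges_in_disjoint S T : [disjoint S & T] -> [disjoint edges_in S & edges_in T].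
Proof.
move=> dST; rewrite disjoint_subset; apply/subsetP => e; rewrite !inE => eS.
apply/negP => eT; have [x [y [_ E]]] := edgeP e.
move: eS eT; rewrite E !subUset !sub1set => /andP[xS _] /andP[xT _].
by have := disjointFr dST xS; rewrite xT.
Qed.

Lemma detached_local U S G : detached U S (G :&: edges_in U) = detached U S G.
Proof.
apply/detachedP/detachedP => H e; last by rewrite inE => /andP[/H].
by move=> eG eU; apply: H => //; rewrite !inE eG.
Qed.

Lemma conn_set_local S G : conn_set S (G :&: edges_in S) = conn_set S G.
Proof.
by rewrite /conn_set; congr andb; apply: eq_forallb => A; rewrite detached_local.
Qed.

Lemma comps_local U G : comps U (G :&: edges_in U) = comps U G.
Proof.
apply/setP => S; rewrite !inE /is_comp detached_local.
case: (boolP (S \subset U)) => //= SU; congr andb.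
rewrite -[RHS]conn_set_local -conn_set_local; congr conn_set.
rewrite -setIA; congr (_ :&: _); apply/setIidPr/subsetP => e; rewrite !inE => eS.
exact: subset_trans eS SU.
Qed.

End Cuts.

(** * Components of the random graph *)

Section Mean.
Import mathcomp.boot.fintype mathcomp.boot.finset.
Local Open Scope set_scope.
Local Open Scope ring_scope.
Variables (R : realType) (p : R).

Definition mean n (X : graph n -> R) : R := \sum_(G : graph n) gnp_pmf p G * X G.

Section basic.
Variable n : nat.
Implicit Types (X Y : graph n -> R) (A B : {set edge n}) (U S : {set 'I_n}).

Lemma eq_mean X Y : X =1 Y -> mean X = mean Y.
Proof. by move=> XY; apply: eq_bigr => G _; rewrite XY. Qed.

Lemma mean1 : mean (fun _ : graph n => 1) = 1.
Proof. by rewrite -[RHS](sum_gnp_pmf n p); apply: eq_bigr => G _; rewrite mulr1. Qed.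

Lemma mean_sum (I : finType) (P : pred I) (F : I -> graph n -> R) :
  mean (fun G => \sum_(i | P i) F i G) = \sum_(i | P i) mean (F i).
Proof.
by rewrite /mean exchange_big; apply: eq_bigr => G _; rewrite mulr_sumr.
Qed.

Lemma meanZ (c : R) X : mean (fun G => c * X G) = c * mean X.
Proof. by rewrite /mean mulr_sumr; apply: eq_bigr => G _; rewrite mulrCA. Qed.

(** Independence of disjoint edge sets: exchanging the edges outside A between
    two independent copies of the graph preserves their joint law. *)
Lemma mean_indep A (X Y : graph n -> R) :
  (forall G : {set edge n}, X (G :&: A) = X G) ->
  (forall G : {set edge n}, Y (G :\: A) = Y G) ->
  mean (fun G => X G * Y G) = mean X * mean Y.
Proof.
move=> XA YA.
(* the exchange of the edges outside A *)
pose f (u : graph n * graph n) : graph n * graph n :=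
  ((u.1 : {set edge n}) :&: A :|: (u.2 : {set edge n}) :\: A,
   (u.2 : {set edge n}) :&: A :|: (u.1 : {set edge n}) :\: A).
have fK : involutive f.
  move=> [G H]; rewrite /f/=; congr (_, _); apply/setP => e; rewrite !inE;
  by case: (e \in A); rewrite /= ?andbT ?andbF ?orbF.
rewrite -[LHS]mulr1 -mean1 /mean !big_distrlr/= !pair_bigA/=.
rewrite [RHS](reindex_inj (inv_inj fK)); apply: eq_bigr => -[G H] _ /=.
set G' : {set edge n} := _ :|: _; set H' : {set edge n} := _ :|: _.
have -> : Y H' = Y G.
  rewrite -YA -[RHS]YA; congr Y; apply/setP => e; rewrite !inE.
  by case: (e \in A); rewrite /= ?andbT ?andbF ?orbF.
have -> : X G' = X G.
  rewrite -XA -[RHS]XA; congr X; apply/setP => e; rewrite !inE.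
  by case: (e \in A); rewrite /= ?andbT ?andbF ?orbF.
have w : gnp_pmf p G' * gnp_pmf p H' = gnp_pmf p G * gnp_pmf p H.
  rewrite /gnp_pmf -!big_split/=; apply: eq_bigr => e _; rewrite !inE.
  case: (e \in A); rewrite /= ?andbT ?andbF ?orbF//.
  by rewrite mulrC.
rewrite mulr1 mulrACA w; ring.
Qed.

Lemma mean_no_edge A :
  mean (fun G => [disjoint (G : {set edge n}) & A]%:R) = (1 - p) ^+ #|A|.
Proof.
transitivity (\prod_(e : edge n) ((if e \in A then 0 else p) + (1 - p))).
  rewrite bigA_distr; apply: eq_bigr => G _.
  have [dGA|] := boolP [disjoint G & A].
    rewrite mulr1; apply: eq_bigr => e _; case: ifPn => // eG.
    by rewrite (disjointFr dGA).
  rewrite -setI_eq0 => /set0Pn[e]; rewrite inE => /andP[eG eA].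
  by rewrite mulr0 (bigD1 e)//= eG eA mul0r.
rewrite (bigID (mem A))/= [X in _ * X]big1 ?mulr1 => [|e /negPf->]; last first.
  by rewrite addrCA subrr addr0.
rewrite (eq_bigr (fun=> 1 - p)) => [|e ->]; last by rewrite add0r.
by rewrite prodr_const.
Qed.

(** Connectedness of S, absence of edges leaving S inside U, and the graph
    induced on the rest of U are determined by three disjoint sets of edges. *)
Lemma mean_is_comp U S (Y : graph n -> R) : S \subset U ->
  (forall G : {set edge n}, Y (G :&: edges_in (U :\: S)) = Y G) ->
  mean (fun G => (is_comp U G S)%:R * Y G) =
  mean (fun G => (conn_set S G)%:R) * (1 - p) ^+ (#|S| * #|U :\: S|) * mean Y.
Proof.
move=> SU YD.
rewrite -(card_edges_across SU) -mean_no_edge.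
transitivity (mean (fun G => (conn_set S G)%:R *
    ([disjoint (G : {set edge n}) & edges_across U S]%:R * Y G))).
  apply: eq_mean => G; rewrite /is_comp SU/= detachedE mulrA -natrM.
  by rewrite mulnb andbC.
have dS : [disjoint edges_in S & edges_in (U :\: S)].
  by apply: edges_in_disjoint; rewrite -setI_eq0 setIDA setIC -setIDA setDv setI0.
rewrite (mean_indep (A := edges_in S)) => [|G|G]; last 2 first.
- by rewrite conn_set_local.
- have -> : [disjoint G :\: edges_in S & edges_across U S] = [disjoint (G : {set edge n}) & edges_across U S].
    rewrite -!setI_eq0 setIDAC; congr (_ == _); apply/setDidPl.
    by rewrite (disjointWl (subsetIr _ _))// edges_across_in.
  congr (_ * _); rewrite -YD -[RHS]YD setIDAC; congr Y; apply/setDidPl.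
  by rewrite (disjointWl (subsetIr _ _))// disjoint_sym.
rewrite -mulrA; congr (_ * _); rewrite (mean_indep (A := edges_across U S)) => // G.
  by rewrite -!setI_eq0 -setIA setIid.
rewrite -YD -[RHS]YD setIDAC; congr Y; apply/setDidPl.
by rewrite (disjointWl (subsetIr _ _))// disjoint_sym edges_across_inD.
Qed.

End basic.

Lemma sum_subsets n (U : {set 'I_n}) (F : nat -> R) :
  \sum_(S : {set 'I_n} | S \subset U) F #|S| = \sum_(k < #|U|.+1) 'C(#|U|, k)%:R * F k.
Proof.
rewrite (partition_big (fun S : {set 'I_n} => inord #|S| : 'I_(#|U|.+1)) xpredT)//=.
apply: eq_bigr => k _; rewrite -cards_draws mulr_natl -sumr_const.
have inE' (S : {set 'I_n}) : S \subset U ->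
    (inord #|S| == k :> 'I_(#|U|.+1)) = (#|S| == k :> nat).
  by move=> SU; rewrite -val_eqE/= inordK// ltnS subset_leq_card.
apply: eq_big => [S|S /andP[SU]]; last by rewrite inE' // => /eqP->.
by rewrite inE; case: (boolP (S \subset U)) => //= SU; rewrite inE'.
Qed.

Definition conn_prob (k : nat) : R :=
  mean (fun G : graph k => (conn_set [set: 'I_k] G)%:R).

(** The mean of [sum_card_comps]. *)
Lemma sum_mean_conn_set n (U : {set 'I_n}) :
  \sum_(S : {set 'I_n} | S \subset U) #|S|%:R *
    (mean (fun G : graph n => (conn_set S G)%:R) * (1 - p) ^+ (#|S| * (#|U| - #|S|)))
  = #|U|%:R.
Proof.
have -> : #|U|%:R = mean (fun G : graph n =>
    \sum_(S : {set 'I_n}) if S \in comps U G then #|S|%:R else 0).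
  rewrite -[LHS]mulr1 -[X in _ * X = _](mean1 n) -meanZ; apply: eq_mean => G.
  by rewrite mulr1 -(sum_card_comps U G) natr_sum big_mkcond.
rewrite mean_sum big_mkcond/=; apply: eq_bigr => S _; case: ifPn => SU; last first.
  symmetry; rewrite /mean big1// => G _; rewrite inE /is_comp (negPf SU).
  by rewrite mulr0.
transitivity (mean (fun G : graph n => #|S|%:R * ((is_comp U G S)%:R * 1))).
  rewrite meanZ mean_is_comp// mean1 mulr1; congr (_ * (_ * _ ^+ (_ * _))).
  by rewrite cardsD; have /setIidPr-> := SU.
by apply: eq_mean => G; rewrite inE mulr1; case: is_comp; rewrite ?mulr1 ?mulr0.
Qed.

(** The identity [sum_mean_conn_set] expresses this probability by those for
    smaller sets in a way that involves only sizes; by induction the number of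
    vertices of the ambient graph does not matter. *)
Lemma mean_conn_set n (S : {set 'I_n}) :
  mean (fun G : graph n => (conn_set S G)%:R) = conn_prob #|S|.
Proof.
have [s] := ubnP #|S|; elim: s n S => // s IHs n S /ltnSE Ss.
have [S0|S0] := eqVneq #|S| 0%N.
  rewrite S0 /conn_prob /mean !big1// => G _; rewrite /conn_set.
    have -> : [set: 'I_0] = set0 by apply/setP => -[].
    by rewrite eqxx mulr0.
  by move/eqP: S0; rewrite cards_eq0 => ->; rewrite mulr0.
have key m (T : {set 'I_m}) : #|T| = #|S| ->
    #|S|%:R * mean (fun G : graph m => (conn_set T G)%:R) =
    #|S|%:R - (\sum_(k < #|S|.+1) 'C(#|S|, k)%:R *
      (k%:R * (conn_prob k * (1 - p) ^+ (k * (#|S| - k)))) -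
      #|S|%:R * conn_prob #|S|).
  move=> TS; have := sum_mean_conn_set T.
  have := sum_subsets T (fun k => k%:R * (conn_prob k * (1 - p) ^+ (k * (#|S| - k)))).
  rewrite (bigD1 T)//= [in X in _ -> X](bigD1 T)//= TS !subnn !muln0 !mulr1 => <-.
  rewrite [X in _ + X = #|S|%:R](eq_bigr (fun U : {set 'I_m} => #|U|%:R *
    (conn_prob #|U| * (1 - p) ^+ (#|U| * (#|S| - #|U|))))) => [h|U /andP[UT UneT]].
    by rewrite -[X in X - _]h; ring.
  rewrite IHs//.
  by rewrite (leq_trans _ Ss)// -TS proper_card// properEneq UneT.
have SR : (#|S|%:R : R) != 0 by rewrite pnatr_eq0.
apply: (mulfI SR); rewrite (key n S)// -(key _ [set: 'I_#|S|])//.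
by rewrite cardsT card_ord.
Qed.

Lemma conn_prob_mass N :
  \sum_(k < N.+1) k%:R * mean_comps (1 - p) conn_prob N k = N%:R.
Proof.
have := sum_mean_conn_set [set: 'I_N]; rewrite cardsT card_ord => <-.
under [RHS]eq_bigr do rewrite mean_conn_set.
have := @sum_subsets N [set: 'I_N] (fun k => k%:R * (conn_prob k * (1 - p) ^+ (k * (N - k)))).
rewrite cardsT card_ord => ->; apply: eq_bigr => k _; rewrite /mean_comps; ring.
Qed.

Hypothesis p01 : 0 <= p <= 1.

Lemma mean_ge0 n (X : graph n -> R) : (forall G, 0 <= X G) -> 0 <= mean X.
Proof. by move=> X0; apply: sumr_ge0 => G _; rewrite mulr_ge0// gnp_pmf_ge0. Qed.

Lemma ler_mean n (X Y : graph n -> R) : (forall G, X G <= Y G) -> mean X <= mean Y.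
Proof. by move=> XY; apply: ler_sum => G _; rewrite ler_wpM2l// gnp_pmf_ge0. Qed.

Lemma conn_prob_ge0 k : 0 <= conn_prob k.
Proof. exact: mean_ge0. Qed.

Definition nb_comps (I : pred nat) n (U : {set 'I_n}) (G : graph n) : nat :=
  #|[set S in comps U G | I #|S| ]|.

Lemma nb_comps_remove (I : pred nat) n (U S : {set 'I_n}) (G : graph n) :
  is_comp U G S -> I #|S| -> nb_comps I (U :\: S) G = (nb_comps I U G).-1.
Proof.
move=> cS IS; have [SD E] := comps_remove cS.
rewrite /nb_comps E (cardsD1 S [set T in _ :|: _ | _]) !inE eqxx IS/=.
apply: eq_card => T; rewrite !inE.
have [->|//] := eqVneq T S; by move: SD; rewrite inE => /negPf->.
Qed.

(** The first member of an ordered tuple of distinct components is chosen, and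
    the others are components of the graph that remains. *)
Lemma ffact_nb_comps (I : pred nat) n (U : {set 'I_n}) (G : graph n) m :
  (nb_comps I U G ^_ m.+1)%:R = \sum_(S : {set 'I_n} | (S \subset U) && I #|S|)
    (is_comp U G S)%:R * (nb_comps I (U :\: S) G ^_ m)%:R :> R.
Proof.
rewrite ffactnS natrM {1}/nb_comps -sum1_card natr_sum mulr_suml.
rewrite big_mkcond [RHS]big_mkcond/=; apply: eq_bigr => S _; rewrite !inE.
case: (boolP (is_comp U G S)) => [cS|_]; last first.
  by rewrite mul0r; case: ifP.
have /and3P[-> _ _] := cS; case: (boolP (I #|S|)) => //= IS.
by rewrite nb_comps_remove.
Qed.

(** One factor for each component removed: after i removals at most n - i l
    vertices are left. The shift j lets the induction start from a smaller set. *)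
Lemma mean_ffact_nb_comps_le (I : pred nat) (l : R) (beta : nat -> R) n m j
    (U : {set 'I_n}) :
  (forall k, I k -> l <= k%:R) -> (forall i, 0 <= beta i) ->
  (forall u i, u%:R + i%:R * l <= n%:R ->
    \sum_(k < u.+1 | I k) mean_comps (1 - p) conn_prob u k <= beta i) ->
  #|U|%:R + j%:R * l <= n%:R ->
  mean (fun G : graph n => (nb_comps I U G ^_ m)%:R) <= \prod_(i < m) beta (j + i)%N.
Proof.
move=> Il b0 bI; elim: m j U => [|m IHm] j U Uj.
  by rewrite big_ord0 -[leRHS](mean1 n); apply: ler_mean => G; rewrite ffactn0.
rewrite (eq_mean (ffact_nb_comps I U ^~ m)) mean_sum.
have pq0 i : 0 <= (1 - p) ^+ i by case/andP: p01 => _ ?; rewrite exprn_ge0// subr_ge0.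
pose F k := if I k then conn_prob k * (1 - p) ^+ (k * (#|U| - k)) else 0.
rewrite big_ord_recl addn0/=.
apply: (@le_trans _ _ ((\sum_(S : {set 'I_n} | S \subset U) F #|S|) *
    \prod_(i < m) beta (j + lift ord0 i)%N)).
  rewrite mulr_suml big_mkcondr; apply: ler_sum => S SU.
  rewrite /F; case: ifPn => [IS|_]; last by rewrite mul0r.
  rewrite mean_is_comp//; last by move=> G; rewrite /nb_comps comps_local.
  rewrite mean_conn_set cardsD; have /setIidPr-> := SU.
  apply: ler_wpM2l; first by rewrite mulr_ge0// conn_prob_ge0.
  under eq_bigr do rewrite /= /bump/= add1n addnS -addSn.
  apply: IHm; rewrite cardsD; have /setIidPr-> := SU.
  rewrite natrB ?subset_leq_card// -natr1 mulrDl mul1r.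
  by have := Il _ IS; lra.
apply: ler_wpM2r; first by rewrite prodr_ge0.
rewrite sum_subsets; apply: le_trans (bI #|U| j Uj).
rewrite [leRHS]big_mkcond; apply: ler_sum => k _; rewrite /F /mean_comps.
by case: ifP => _; rewrite ?mulr0 ?mulrA.
Qed.

End Mean.

(** * Factorial moments of the number of critical components *)

Lemma sum_squares_ge {R : realType} (q : nat) :
  q%:R ^+ 3 / 3 <= \sum_(i < q) i.+1%:R ^+ 2 :> R.
Proof.
elim: q => [|q IHq]; first by rewrite big_ord0 expr0n/= mul0r.
rewrite big_ord_recr/=; apply: le_trans (lerD IHq (lexx _)).
have q0 : (0 : R) <= q%:R by [].
by rewrite -natr1; nra.
Qed.

Section moments.
Variables (R : realType) (lambda a b : R).
Hypotheses (a0 : 0 < a) (b0 : 0 < b).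

Definition mass_window (n : nat) : pred nat := fun k => a <= n%:R `^ (- (2 / 3)) * k%:R <= b.

Definition nb_window n (G : graph n) : nat := nb_comps (mass_window n) [set: 'I_n]%SET G.

Lemma powR_cube_root (n m : nat) : n%:R `^ (m%:R / 3) = (n%:R `^ (1 / 3)) ^+ m :> R.
Proof.
by rewrite -powR_mulrn ?powR_ge0// -powRrM; congr (_ `^ _); field.
Qed.

Lemma mean_ffact_nb_window_large : exists C c : R, [/\ 0 < C, 0 < c & exists n1 : nat,
  forall n m : nat, (n1 <= n)%N -> 0 <= p_crit lambda n <= 1 ->
    mean (p_crit lambda n) (fun G : graph n => (nb_window G ^_ m)%:R) <=
    C ^+ m * expR (- c * m%:R ^+ 3)].
Proof.
pose Lam := `|lambda| + 1.
have Lam1 : 1 <= Lam by rewrite /Lam lerDr.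
pose X := 4 * (Lam + b).
have X0 : 0 < X by have := b0; rewrite /X; lra.
pose c0 := window_rate a; pose C0 := 32 * expR (window_cost a b Lam) / a ^+ 3.
have c00 : 0 < c0 by rewrite /c0 /window_rate divr_gt0// exprn_gt0.
have C00 : 0 < C0 by rewrite /C0 divr_gt0 ?exprn_gt0// mulr_gt0// expR_gt0.
exists C0, (c0 / 3); split=> //; first by rewrite divr_gt0.
exists (Num.truncn (X ^+ 3)).+1 => n m n1n p01.
pose s := n%:R `^ (1 / 3) : R.
have s0 : 0 <= s by rewrite powR_ge0.
have s3 : s ^+ 3 = n%:R.
  by rewrite /s -powR_cube_root divff// powRr1.
have Xs : X <= s.
  rewrite leNgt; apply/negP => sX.
  have : s ^+ 3 < X ^+ 3 by rewrite ltrXn2r.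
  rewrite s3 => nX.
  have := truncnS_gt (X ^+ 3); rewrite ltNge => /negP; apply.
  by apply: le_trans (ltW nX); rewrite ler_nat.
have sp : 0 < s by apply: lt_le_trans X0 Xs.
have pE : p_crit lambda n = s ^- 3 + lambda * s ^- 4.
  by rewrite /p_crit -s3 powRN -[in RHS]/s s3 powR_cube_root.
have n23 : n%:R `^ (- (2 / 3)) = s ^- 2 :> R by rewrite powRN powR_cube_root.
pose beta j := C0 * expR (- c0 * j.+1%:R ^+ 2).
have beta0 j : 0 <= beta j by rewrite mulr_ge0 ?expR_ge0// ltW.
have Iab k : mass_window n k -> a * s ^+ 2 <= k%:R <= b * s ^+ 2.
  rewrite /mass_window n23 => /andP[].
  by rewrite ler_pdivlMl ?exprn_gt0// ler_pdivrMl ?exprn_gt0// ![s ^+ 2 * _]mulrC => -> ->.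
apply: (@le_trans _ _ (\prod_(i < m) beta (0 + i)%N)).
  apply: (mean_ffact_nb_comps_le p01 (l := a * s ^+ 2)) => //.
  - by move=> k /Iab/andP[].
  - move=> u i ui; rewrite /beta /C0 /c0.
    apply: (critical_window (lambda := lambda) (s := s) (n := n) a0 b0 (lexx _)) => //.
      exact: conn_prob_ge0.
    exact: conn_prob_mass.
  - by rewrite cardsT card_ord mul0r addr0.
rewrite /beta big_split/= prodr_const card_ord; apply: ler_wpM2l.
  by rewrite exprn_ge0// ltW.
rewrite -expR_sum ler_expR -mulr_sumr !mulNr lerN2 -mulrA ler_pM2l//.
rewrite mulrC; exact: sum_squares_ge.
Qed.

(** For the finitely many n below the range of [mean_ffact_nb_window_large] the
    number of components is bounded, and a large C takes care of them. *)
Lemma mean_ffact_nb_window (n0 : nat) :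
  (forall n, (n0 <= n)%N -> 0 < p_crit lambda n < 1) ->
  exists C c : R, [/\ 0 < C, 0 < c &
  forall n m : nat, (n0 <= n)%N ->
    mean (p_crit lambda n) (fun G : graph n => (nb_window G ^_ m)%:R) <=
    C ^+ m * expR (- c * m%:R ^+ 3)].
Proof.
move=> hn0.
have [C0 [c [C00 c0 [n1 H]]]] := mean_ffact_nb_window_large.
pose M : R := (2 ^ n1)%:R.
have M0 : 0 < M by rewrite ltr0n expn_gt0.
(* Falling factorials of order above M vanish, and m^3 <= m M^2 below. *)
pose C := C0 + M * expR (c * M ^+ 2).
have MC : 0 < M * expR (c * M ^+ 2) by rewrite mulr_gt0 ?expR_gt0.
have C0' : 0 < C by rewrite addr_gt0.
exists C, c; split => // n m n0n.
have p01 : 0 <= p_crit lambda n <= 1.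
  by have /andP[/ltW-> /ltW->] := hn0 n n0n.
have [n1n|nn1] := leqP n1 n.
  apply: le_trans (H n m n1n p01) _; apply: ler_wpM2r; first exact: expR_ge0.
  by apply: lerXn2r; rewrite ?nnegrE ?(ltW C00) ?(ltW C0')// /C lerDl ltW.
have NM (G : graph n) : (nb_window G <= 2 ^ n1)%N.
  apply: (@leq_trans (2 ^ n)); last by rewrite leq_exp2l// ltnW.
  apply: leq_trans (max_card _) _.
  by rewrite -cardsT -powersetT card_powerset cardsT card_ord.
have [mM|Mm] := leqP m (2 ^ n1); last first.
  apply: (@le_trans _ _ 0); last by rewrite mulr_ge0 ?expR_ge0 ?exprn_ge0// ltW.
  rewrite /mean big1// => G _; rewrite ffact_small ?mulr0//.
  exact: leq_ltn_trans (NM G) Mm.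
apply: (@le_trans _ _ (M ^+ m)).
  rewrite -[leRHS]mulr1 -[X in _ * X](mean1 (p_crit lambda n) n) -meanZ.
  apply: ler_mean => // G; rewrite mulr1 /M -natrX ler_nat.
  elim: m {mM} => // m IHm; rewrite ffactnSr expnSr leq_mul//.
  exact: leq_trans (leq_subr _ _) (NM G).
apply: (@le_trans _ _ ((M * expR (c * M ^+ 2)) ^+ m * expR (- c * m%:R ^+ 3))); last first.
  apply: ler_wpM2r; first exact: expR_ge0.
  by apply: lerXn2r; rewrite ?nnegrE ?(ltW MC) ?(ltW C0')// /C lerDr ltW.
rewrite exprMn -mulrA ler_peMr ?exprn_ge0 ?(ltW M0)//.
rewrite -expRM_natl -expRD -[leLHS]expR0 ler_expR.
have mMR : m%:R <= M :> R by rewrite ler_nat.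
have -> : m%:R * (c * M ^+ 2) + - c * m%:R ^+ 3 = c * (m%:R * (M ^+ 2 - m%:R ^+ 2)) by ring.
rewrite mulr_ge0 ?(ltW c0)// mulr_ge0// subr_ge0.
by apply: lerXn2r; rewrite ?nnegrE// ltW.
Qed.

End moments.

(** * Integrals as finite sums *)

Section TupleSums.
Import mathcomp.boot.fintype mathcomp.boot.finset.
Local Open Scope set_scope.
Local Open Scope ring_scope.

(** Every set of size q is listed by q! tuples. *)
Lemma sum_uniq_tuples (K : comNzRingType) (T : finType) (F : T -> K) (q : nat) :
  \sum_(t : q.-tuple T | uniq t) \prod_(i < q) F (tnth t i) =
  q`!%:R * \sum_(S : {set T} | #|S| == q) \prod_(x in S) F x.
Proof.
rewrite (partition_big (fun t : q.-tuple T => [set x in t]) (fun S : {set T} => #|S| == q)).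
  rewrite mulr_sumr; apply: eq_bigr => S /eqP Sq.
  have setE (t : q.-tuple T) : uniq t && ([set x in t] == S) = all (mem S) t && uniq t.
    apply/andP/andP => -[].
      move=> ut /eqP <-; split=> //; apply/allP => x xt.
      by rewrite /= inE.
    move=> /allP tS ut; split => //; rewrite eqEcard Sq cardsE (card_uniqP ut) size_tuple leqnn andbT.
    by apply/subsetP => x; rewrite inE => /tS.
  rewrite (eq_bigl _ _ setE) [LHS](eq_bigr (fun=> \prod_(x in S) F x)); last first.
    move=> t h; have /andP[ut /eqP <-] : uniq t && ([set x in t] == S) by rewrite setE.
    rewrite -(big_tuple _ _ t xpredT F) /= big_uniq//=.
    by apply: eq_bigl => x; rewrite inE.
  have -> : q`! = #|[set t : q.-tuple T | all (mem S) t & uniq t]|.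
    by rewrite card_uniq_tuples Sq ffactnn.
  by rewrite mulr_natl -sumr_const; apply: eq_bigl => t; rewrite inE.
by move=> t ut; rewrite cardsE (card_uniqP ut) size_tuple.
Qed.

Lemma prod_1D (K : comNzRingType) (T : finType) (F : T -> K) :
  \prod_(x : T) (1 + F x) = \sum_(S : {set T}) \prod_(x in S) F x.
Proof.
under eq_bigr do rewrite addrC.
rewrite bigA_distr; apply: eq_bigr => S _; rewrite [RHS]big_mkcond.
by apply: eq_bigr => x _; case: (x \in S).
Qed.

Lemma prod_1D_tuples (K : fieldType) (T : finType) (F : T -> K) (m : nat) :
  [pchar K] =i pred0 -> (#|T| <= m)%N ->
  \prod_(x : T) (1 + F x) = \sum_(0 <= q < m.+1)
    (q`!%:R)^-1 * \sum_(t : q.-tuple T | uniq t) \prod_(i < q) F (tnth t i).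
Proof.
move=> K0 Tm; rewrite prod_1D big_mkord.
rewrite (partition_big (fun S : {set T} => inord #|S| : 'I_m.+1) xpredT)//=.
apply: eq_bigr => q _; rewrite sum_uniq_tuples mulKf; last first.
  by have /pcharf0P -> := K0; rewrite -lt0n fact_gt0.
apply: eq_bigl => S; rewrite -val_eqE/= inordK// ltnS.
exact: leq_trans (max_card _) Tm.
Qed.

Lemma sum_uniq_tuples_indicator (K : comNzRingType) (T : finType) (P : pred T) (c : K) q :
  \sum_(t : q.-tuple T | uniq t) \prod_(i < q) (if P (tnth t i) then c else 0) =
  c ^+ q * (#|P| ^_ q)%:R.
Proof.
rewrite -(card_uniq_tuples q P) mulr_natr -sumr_const big_mkcond [RHS]big_mkcond/=.
apply: eq_bigr => t _; rewrite inE andbC; case: (uniq t) => //=.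
case: ifPn => [/allP tP|].
  rewrite (eq_bigr (fun=> c)) ?prodr_const ?card_ord// => i _.
  by rewrite tP// mem_tnth.
rewrite -has_predC => /hasP[x /tnthP[i ->] /negPf xP].
by rewrite (bigD1 i)//= xP mul0r.
Qed.

End TupleSums.

Local Open Scope classical_set_scope.

Section Functional.
Context d (T : measurableType d) (R : realType).

(** An integration formula known for nonnegative functions extends to all
    measurable ones by positive and negative parts. *)
Lemma Rintegral_functional (mu : {measure set T -> \bar R}) (L : (T -> R) -> R) (f : T -> R) :
  (forall f1 f2, L (f1 - f2) = L f1 - L f2) ->
  (forall g : T -> R, (forall x, (0 <= g x)%R) -> measurable_fun setT g ->
    \int[mu]_x (g x)%:E = (L g)%:E)%E ->
  measurable_fun setT f -> \int[mu]_x f x = L f.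
Proof.
move=> LB LE mf; rewrite /Rintegral integralE.
rewrite (_ : (fun x => (f x)%:E) = EFin \o f)//.
have := funerpos f; have := funerpos (- f).
rewrite (_ : EFin \o (- f) = (\- (EFin \o f))%E); last by apply/funext => x.
rewrite funeposN funrposN => -> ->.
have hp := LE _ (funrpos_ge0 f) (measurable_funrpos mf).
have mN : measurable_fun setT f^\-.
  by rewrite -funrposN; apply: measurable_funrpos; exact: measurableT_comp.
have hn : (forall x, 0 <= f^\- x) by rewrite -funrposN; exact: funrpos_ge0.
rewrite hp (LE _ hn mN).
by rewrite -EFinB/= -LB funrposBneg.
Qed.

End Functional.

Local Open Scope complex_scope.

Lemma ReD {R : realType} (x y : R[i]) : complex.Re (x + y) = complex.Re x + complex.Re y.
Proof. by case: x y => ? ? []. Qed.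
Lemma ImD {R : realType} (x y : R[i]) : complex.Im (x + y) = complex.Im x + complex.Im y.
Proof. by case: x y => ? ? []. Qed.
Lemma Re_sum {R : realType} I (r : seq I) (P : pred I) (F : I -> R[i]) :
  complex.Re (\sum_(i <- r | P i) F i) = \sum_(i <- r | P i) complex.Re (F i).
Proof. by rewrite (big_morph _ ReD (erefl : complex.Re (0 : R[i]) = 0)). Qed.
Lemma Im_sum {R : realType} I (r : seq I) (P : pred I) (F : I -> R[i]) :
  complex.Im (\sum_(i <- r | P i) F i) = \sum_(i <- r | P i) complex.Im (F i).
Proof. by rewrite (big_morph _ ImD (erefl : complex.Im (0 : R[i]) = 0)). Qed.
Lemma ReZ {R : realType} (c : R) (x : R[i]) : complex.Re (c%:C * x) = c * complex.Re x.
Proof. by case: x => a b /=; rewrite mul0r subr0. Qed.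
Lemma ImZ {R : realType} (c : R) (x : R[i]) : complex.Im (c%:C * x) = c * complex.Im x.
Proof. by case: x => a b /=; rewrite mul0r addr0. Qed.
Lemma ReIm_eq {R : realType} (x y : R[i]) :
  complex.Re x = complex.Re y -> complex.Im x = complex.Im y -> x = y.
Proof. by case: x y => a b [c d] /= -> ->. Qed.

Section Bridge.
Context {R : realType}.
Variables (n : nat) (p : R).
Hypothesis p01 : 0 <= p <= 1.

Definition cmean (X : graph n -> R[i]) : R[i] := \sum_(G : graph n) (gnp_pmf p G)%:C * X G.

Lemma Re_cmean X : complex.Re (cmean X) = mean p (fun G => complex.Re (X G)).
Proof. by rewrite /cmean Re_sum; apply: eq_bigr => G _; rewrite ReZ. Qed.

Lemma Im_cmean X : complex.Im (cmean X) = mean p (fun G => complex.Im (X G)).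
Proof. by rewrite /cmean Im_sum; apply: eq_bigr => G _; rewrite ImZ. Qed.

Lemma gnpE (A : set (graph n)) :
  gnp n p A = (mean p (fun G => (G \in A)%:R))%:E.
Proof.
rewrite /gnp p01 /mean -sumEFin big_mkcond/=; apply: eq_bigr => G _.
by case: (G \in A); rewrite ?mulr1 ?mulr0.
Qed.

Lemma gnp_set1 (G : graph n) : gnp n p [set G] = (gnp_pmf p G)%:E.
Proof.
rewrite gnpE /mean (bigD1 G)//= mem_set// mulr1 big1 ?addr0// => H HG.
by rewrite in_set1 (negPf HG) mulr0.
Qed.

Lemma integral_gnp (X : graph n -> R) : (forall G, 0 <= X G) ->
  (\int[gnp n p]_G (X G)%:E = (mean p X)%:E)%E.
Proof.
move=> X0; rewrite ge0_integral_gnp => [|G]; last by rewrite lee_fin.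
rewrite /mean -sumEFin; apply: eq_bigr => G _.
by rewrite gnp_set1.
Qed.

Lemma meanB (X Y : graph n -> R) : mean p (X - Y) = mean p X - mean p Y.
Proof. by rewrite /mean -sumrB; apply: eq_bigr => G _; rewrite -mulrBr. Qed.

Lemma Rintegral_gnp (X : graph n -> R) : \int[gnp n p]_G X G = mean p X.
Proof.
apply: (@Rintegral_functional _ _ _ (gnp n p) (fun X => mean p X)) => //.
- exact: meanB.
- by move=> g g0 _; exact: integral_gnp.
Qed.

Lemma expectation_gnp (X : graph n -> R) : (forall G, 0 <= X G) ->
  ('E_(gnp n p)[X] = (mean p X)%:E)%E.
Proof. by move=> X0; rewrite unlock integral_gnp. Qed.

Lemma complex_integral_gnp X : complex_integral (gnp n p) X = cmean X.
Proof.
rewrite /complex_integral; apply: ReIm_eq => /=.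
  by rewrite Rintegral_gnp Re_cmean.
by rewrite Rintegral_gnp Im_cmean.
Qed.

Lemma complex_integral_factorial_moment q (g : q.-tuple (state R) -> R[i]) :
  measurable_fun setT (fun z => complex.Re (g z)) ->
  measurable_fun setT (fun z => complex.Im (g z)) ->
  complex_integral (factorial_moment n p q) g =
  cmean (fun G => \sum_(t : q.-tuple (component G) | uniq t) g (map_tuple (@atom n G R) t)).
Proof.
pose L (f : q.-tuple (state R) -> R) := mean p (fun G =>
  \sum_(t : q.-tuple (component G) | uniq t) f (map_tuple (@atom n G R) t)).
have LB f1 f2 : L (f1 - f2) = L f1 - L f2.
  rewrite /L -meanB; apply: eq_mean => G /=.
  by rewrite -[RHS]sumrB.
have LE (f : q.-tuple (state R) -> R) : (forall x, 0 <= f x) -> measurable_fun setT f ->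
    (\int[factorial_moment n p q]_x (f x)%:E = (L f)%:E)%E.
  move=> f0 mf; have f0' z : (0 <= (f z)%:E)%E by rewrite lee_fin.
  have mf' : measurable_fun setT (fun z => (f z)%:E) by exact/measurable_EFinP.
  rewrite (@ge0_integral_factorial_moment R n p q _ f0' mf') -integral_gnp; last by move=> G; exact: sumr_ge0.
  by apply: eq_integral => G _; rewrite sumEFin.
move=> mR mI; apply: ReIm_eq => /=.
  rewrite (Rintegral_functional LB LE mR) Re_cmean; apply: eq_mean => G.
  by rewrite Re_sum.
rewrite (Rintegral_functional LB LE mI) Im_cmean; apply: eq_mean => G.
by rewrite Im_sum.
Qed.

End Bridge.

Lemma complex_integral_Xi {R : realType} n (G : graph n) (f : state R -> R[i]) :
  measurable_fun setT (fun z => complex.Re (f z)) ->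
  measurable_fun setT (fun z => complex.Im (f z)) ->
  complex_integral (Xi R G) f = \sum_(C : component G) f (atom R C).
Proof.
pose L (f : state R -> R) := \sum_(C : component G) f (atom R C).
have LB f1 f2 : L (f1 - f2) = L f1 - L f2 by rewrite /L -sumrB.
have LE (g : state R -> R) : (forall x, 0 <= g x) -> measurable_fun setT g ->
    (\int[Xi R G]_x (g x)%:E = (L g)%:E)%E.
  move=> g0 mg; have g0' z : (0 <= (g z)%:E)%E by rewrite lee_fin.
  have mg' : measurable_fun setT (fun z => (g z)%:E) by exact/measurable_EFinP.
  rewrite ge0_integral_fin_msum// /L -sumEFin; apply: eq_bigr => C _.
  by rewrite integral_dirac// ?diracT ?mul1e//; exact/measurable_EFinP.
move=> mR mI; apply: ReIm_eq => /=.
  by rewrite (Rintegral_functional LB LE mR) Re_sum.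
by rewrite (Rintegral_functional LB LE mI) Im_sum.
Qed.

Section Count.
Context {R : realType} {n : nat}.
Implicit Type (G : graph n).

Definition nb_atoms (B : set (state R)) G : nat :=
  #|[pred C : component G | `[< B (atom R C) >] ]|.

Lemma XiE (B : set (state R)) G : Xi R G B = (nb_atoms B G)%:R%:E.
Proof.
rewrite /Xi/= /fin_msum /nb_atoms -sum1_card natr_sum -sumEFin [RHS]big_mkcond/=.
apply: eq_bigr => C _; rewrite diracE seq.inE /=.
by case: asboolP => h; [rewrite mem_set|rewrite memNset].
Qed.

Lemma falling_nat (m q : nat) : falling (m%:R : R) q = (m ^_ q)%:R.
Proof.
rewrite /falling; have [qm|mq] := leqP q m.
  rewrite ffact_prod natr_prod; apply: eq_bigr => i _.
  by rewrite natrB// (leq_trans (ltnW (ltn_ord i))).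
by rewrite ffact_small// (bigD1 (Ordinal mq))//= subrr mul0r.
Qed.

Lemma nb_atoms_le_nb_window (a b : R) (B : set (state R)) G :
  (forall z, B z -> a <= val z.1 <= b) -> (nb_atoms B G <= nb_window a b G)%N.
Proof.
move=> BI; rewrite /nb_window /nb_comps /nb_atoms -(card_imset _ val_inj).
apply/subset_leq_card/fintype.subsetP => S /imsetP[C + ->].
rewrite seq.inE => /asboolP/BI /= w; rewrite finset.inE /mass_window w andbT.
by rewrite -componentsE; exact: valP C.
Qed.

End Count.

(** * Topology of the complex plane and of the state space *)

Section ComplexTopology.
Variable R : realType.

Lemma cnormE (z : R[i]) : `|z| = (cnorm z)%:C.
Proof. by case: z. Qed.

Lemma cnorm_ge0 (z : R[i]) : 0 <= cnorm z.
Proof. by rewrite -ler0c -cnormE. Qed.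

Lemma ler_cnormD (x y : R[i]) : cnorm (x + y) <= cnorm x + cnorm y.
Proof. exact: le_normcD. Qed.

Lemma cnormM (x y : R[i]) : cnorm (x * y) = cnorm x * cnorm y.
Proof. exact: ComplexField.Normc.normcM. Qed.

Lemma cnorm_real (x : R) : cnorm x%:C = `|x|.
Proof. by rewrite /cnorm/= expr0n/= addr0 sqrtr_sqr. Qed.

Lemma cnormN (x : R[i]) : cnorm (- x) = cnorm x.
Proof. exact: normcN. Qed.

Lemma Re_le_cnorm (z : R[i]) : `|complex.Re z| <= cnorm z.
Proof. by rewrite -lecR -cnormE; exact: normc_ge_Re. Qed.

Lemma Im_le_cnorm (z : R[i]) : `|complex.Im z| <= cnorm z.
Proof.
case: z => x y; rewrite /cnorm/= -sqrtr_sqr ler_sqrt ?addr_ge0 ?sqr_ge0//.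
by rewrite lerDr sqr_ge0.
Qed.

Lemma cnorm_le_ReIm (z : R[i]) : cnorm z <= `|complex.Re z| + `|complex.Im z|.
Proof.
case: z => x y; rewrite [complex.Re _]/= [complex.Im _]/=.
have -> : x +i* y = x%:C + y%:C * 'i by apply/eqP; rewrite eq_complex/= !(mul0r, mulr0, mulr1, addr0, add0r, subr0) !eqxx.
apply: le_trans (ler_cnormD _ _) _; rewrite cnormM !cnorm_real.
by rewrite /cnorm/= expr0n/= add0r expr1n sqrtr1 mulr1.
Qed.

Lemma ReB (x y : R[i]) : complex.Re (x - y) = complex.Re x - complex.Re y.
Proof. by case: x y => ? ? []. Qed.

Lemma ImB (x y : R[i]) : complex.Im (x - y) = complex.Im x - complex.Im y.
Proof. by case: x y => ? ? []. Qed.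

(** The radii of the balls of the normed module R[i] are themselves complex
    numbers; this replaces them by real ones. *)
Lemma nbhs_complexP (z : R[i]^o) (P : set R[i]^o) : nbhs z P <->
  exists2 e : R, 0 < e & forall w : R[i], cnorm (z - w) < e -> P w.
Proof.
split=> [/nbhs_ballP[e /= e0]|[e e0 sP]].
  rewrite -ball_normE/= => sP.
  have eR : e = (complex.Re e)%:C by rewrite RRe_real// gtr0_real.
  exists (complex.Re e); first by rewrite -ltcR -eR.
  by move=> w zw; apply: sP => /=; rewrite eR cnormE ltcR.
apply/nbhs_ballP; exists e%:C; rewrite /= ?ltcR//.
by rewrite -ball_normE/= => w zw; apply: sP; rewrite -ltcR -cnormE.
Qed.

Lemma Re_continuous : continuous (@complex.Re R : R[i]^o -> R).
Proof.
move=> z A /nbhs_ballP[e /= e0 sA]; apply/nbhs_complexP; exists e => // w zw.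
apply: sA; rewrite -ball_normE/= -ReB.
exact: le_lt_trans (Re_le_cnorm _) zw.
Qed.

Lemma Im_continuous : continuous (@complex.Im R : R[i]^o -> R).
Proof.
move=> z A /nbhs_ballP[e /= e0 sA]; apply/nbhs_complexP; exists e => // w zw.
apply: sA; rewrite -ball_normE/= -ImB.
exact: le_lt_trans (Im_le_cnorm _) zw.
Qed.

Lemma complex_continuous (T : topologicalType) (g : T -> R[i]^o) :
  continuous (fun x => complex.Re (g x) : R) -> continuous (fun x => complex.Im (g x) : R) ->
  continuous g.
Proof.
move=> cR cI z A /nbhs_complexP[e e0 sA].
have e0' : 0 < e / 2 by rewrite divr_gt0.
have /cvgrPdist_lt/(_ _ e0') hR := cR z.
have /cvgrPdist_lt/(_ _ e0') hI := cI z.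
rewrite nbhs_filterE; near=> w; apply: sA; apply: le_lt_trans (cnorm_le_ReIm _) _.
rewrite ReB ImB (_ : e = e / 2 + e / 2); last by field.
by apply: ltrD; near: w.
Unshelve. all: by end_near. Qed.

(** The real and imaginary parts of [cexp] have this form. *)
Lemma continuous_expRM (T : topologicalType) (g : R -> R) (u v : T -> R) :
  continuous g -> continuous u -> continuous v ->
  continuous (fun x => expR (u x) * g (v x)).
Proof.
move=> cg cu cv z; apply: cvgM.
  by apply: continuous_comp; [exact: cu|exact: continuous_expR].
by apply: continuous_comp; [exact: cv|exact: cg].
Qed.

Lemma cexp_continuous : continuous (@cexp R : R[i]^o -> R[i]^o).
Proof.
apply: complex_continuous.
  rewrite (_ : (fun _ => _) =
    (fun z : R[i]^o => expR (complex.Re z) * cos (complex.Im z))); last first.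
    by apply/funext => z; rewrite /cexp/= mul0r subr0.
  apply: (continuous_expRM (@continuous_cos R) Re_continuous Im_continuous).
rewrite (_ : (fun _ => _) =
  (fun z : R[i]^o => expR (complex.Re z) * sin (complex.Im z))); last first.
  by apply/funext => z; rewrite /cexp/= mul0r addr0.
apply: (continuous_expRM (@continuous_sin R) Re_continuous Im_continuous).
Qed.

Lemma continuous_reflect_sub (K : numFieldType) (V : normedModType K) (g : V -> V) (c : V) :
  continuous g -> continuous (fun w => g (- w) - c).
Proof.
move=> cg w; apply: cvgB; last exact: cvg_cst.
by apply: continuous_comp; [exact: opp_continuous|exact: cg].
Qed.

Lemma cnorm_cexp (z : R[i]) : cnorm (cexp z) = expR (complex.Re z).
Proof.
rewrite /cexp cnormM cnorm_real ger0_norm ?expR_ge0//.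
by rewrite /cnorm/= cos2Dsin2 sqrtr1 mulr1.
Qed.

Lemma cexpD (x y : R[i]) : cexp (x + y) = cexp x * cexp y.
Proof.
case: x y => a b [c d]; apply/eqP; rewrite eq_complex /cexp/=.
rewrite expRD cosD sinD; apply/andP; split; apply/eqP; ring.
Qed.

Lemma cexp0 : cexp (0 : R[i]) = 1.
Proof.
by apply/eqP; rewrite eq_complex/= expR0 cos0 sin0 !(mulr0, mul0r, mulr1, addr0, subr0) !eqxx.
Qed.

Lemma cexp_sum I (r : seq I) (P : pred I) (F : I -> R[i]) :
  cexp (\sum_(i <- r | P i) F i) = \prod_(i <- r | P i) cexp (F i).
Proof. exact: (big_morph _ cexpD cexp0). Qed.

End ComplexTopology.

Section StateTopology.
Variable R : realType.

Definition mass (z : state R) : R := val z.1.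

Lemma mass_continuous : continuous (mass : state R -> R).
Proof.
move=> z; apply: (@continuous_comp _ _ _ (fst : state R -> _) (set_val : [set x : R | 0 < x] -> R)).
  exact: cvg_fst.
exact: initial_continuous.
Qed.

Lemma mass_gt0 (z : state R) : 0 < mass z.
Proof. by have := valP z.1; rewrite inE. Qed.

(** The mass and its inverse are both continuous, hence bounded on K: a compact
    part of the open half-line keeps away from both ends. *)
Lemma compact_mass (K : set (state R)) : compact K ->
  exists a b : R, [/\ 0 < a, 0 < b & forall z, K z -> a <= mass z <= b].
Proof.
move=> cK.
have bnd (g : state R -> R) : continuous g -> exists2 b : R, 0 < b & forall z, K z -> g z <= b.
  move=> cg; have := continuous_compact (continuous_subspaceT cg) cK.
  move=> /compact_bounded[M [_ MK]]; exists (`|M| + 1); first by rewrite ltr_wpDl.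
  move=> z Kz; apply: le_trans (ler_norm _) _.
  by apply: (MK (`|M| + 1)); [rewrite ltr_pwDr// ler_norm|exists z].
have [b b0 Kb] := bnd _ mass_continuous.
have ic : continuous (fun z => (mass z)^-1).
  move=> z; apply: cvgV; first by rewrite gt_eqF// mass_gt0.
  exact: mass_continuous.
have [a a0 Ka] := bnd _ ic.
exists a^-1, b; split; rewrite ?invr_gt0// => z Kz; rewrite Kb// andbT.
by rewrite invf_ple ?posrE ?mass_gt0// Ka.
Qed.

(** The mass and the surplus are continuous with values in Hausdorff spaces, and
    together they determine the state. *)
Lemma state_hausdorff : hausdorff_space (state R).
Proof.
move=> x y xy.
have sep (V : topologicalType) (g : state R -> V) :
    hausdorff_space V -> continuous g -> g x = g y.
  move=> hV cg; apply: hV => A B gA gB.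
  have [z [Az Bz]] := xy _ _ (cg x A gA) (cg y B gB).
  by exists (g z).
have e1 := sep R mass (@norm_hausdorff _ _) mass_continuous.
have e2 : x.2 = y.2.
  apply: (sep nat snd) => [|z]; last exact: cvg_snd.
  exact: discrete_hausdorff.
case: x y e1 e2 {xy sep} => [x1 x2] [y1 y2]; rewrite /mass/= => /val_inj -> -> //.
Qed.

Lemma compact_closure_sub (B K : set (state R)) : compact K -> B `<=` K -> closure B `<=` K.
Proof.
move=> cK BK; have clK := compact_closed state_hausdorff cK.
by rewrite (closure_id K).1//; exact: closure_subset.
Qed.

Lemma borel_fun_Re (h : state R -> R[i]) : borel_fun h ->
  measurable_fun setT (fun z => complex.Re (h z) : R).
Proof.
move=> bh; apply: (measurability _ (RGenOInfty.measurableE R)) => // _ [_ [x ->] <-].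
rewrite setTI; apply: (bh (@complex.Re R @^-1` `]x, +oo[)).
apply: open_comp => [z _|]; first exact: Re_continuous.
exact: interval_open.
Qed.

Lemma borel_fun_Im (h : state R -> R[i]) : borel_fun h ->
  measurable_fun setT (fun z => complex.Im (h z) : R).
Proof.
move=> bh; apply: (measurability _ (RGenOInfty.measurableE R)) => // _ [_ [x ->] <-].
rewrite setTI; apply: (bh (@complex.Im R @^-1` `]x, +oo[)).
apply: open_comp => [z _|]; first exact: Im_continuous.
exact: interval_open.
Qed.

Lemma measurable_prod_tnth (h : state R -> R[i]) (q : nat) : borel_fun h ->
  measurable_fun setT (fun z : q.-tuple (state R) => complex.Re (\prod_(i < q) h (tnth z i)) : R) /\
  measurable_fun setT (fun z : q.-tuple (state R) => complex.Im (\prod_(i < q) h (tnth z i)) : R).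
Proof.
move=> bh.
have mR i : measurable_fun setT (fun z : q.-tuple (state R) => complex.Re (h (tnth z i)) : R).
  exact: (measurableT_comp (borel_fun_Re bh) (measurable_tnth i)).
have mI i : measurable_fun setT (fun z : q.-tuple (state R) => complex.Im (h (tnth z i)) : R).
  exact: (measurableT_comp (borel_fun_Im bh) (measurable_tnth i)).
elim: (index_enum _) => [|i r [IR II]].
  by under eq_fun do rewrite big_nil; under [X in _ /\ measurable_fun _ X]eq_fun do rewrite big_nil; split.
have ReM (x y : R[i]) : complex.Re (x * y) = complex.Re x * complex.Re y - complex.Im x * complex.Im y.
  by case: x y => ? ? [].
have ImM (x y : R[i]) : complex.Im (x * y) = complex.Re x * complex.Im y + complex.Im x * complex.Re y.
  by case: x y => ? ? [].
split.
  under eq_fun do rewrite big_cons ReM.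
  by apply: measurable_funB; apply: measurable_funM.
under eq_fun do rewrite big_cons ImM.
by apply: measurable_funD; apply: measurable_funM.
Qed.

Lemma test_fun_indicator (K B : set (state R)) : compact K -> measurable B -> B `<=` K ->
  test_fun K (fun z => if `[< B z >] then -1 else 0 : R[i]).
Proof.
move=> cK mB BK; split.
- move=> U oU.
  have -> : (fun z => if `[< B z >] then -1 else 0 : R[i]) @^-1` U =
      (B `&` [set _ | U (-1)]) `|` (~` B `&` [set _ | U 0]).
    apply/seteqP; split => z /=; case: asboolP => Bz.
    + by left. + by right. + by case=> -[]. + by case=> -[].
  apply: measurableU; apply: measurableI => //; try exact: measurableC.
    have [h|h] := pselect (U (-1)).
      by rewrite (_ : [set _ | _] = setT)//; apply/seteqP; split.
    by rewrite (_ : [set _ | _] = set0)//; apply/seteqP; split.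
  have [h|h] := pselect (U 0).
    by rewrite (_ : [set _ | _] = setT)//; apply/seteqP; split.
  by rewrite (_ : [set _ | _] = set0)//; apply/seteqP; split.
- exists 1 => z; case: asboolP => _; last by rewrite cnorm_real normr0.
  by rewrite cnormN cnorm_real normr1.
- apply: compact_closure_sub => // z /=; case: asboolP => [/BK//|_].
  by rewrite eqxx.
Qed.

Lemma test_fun_cexp (K : set (state R)) (f : state R -> R[i]) : test_fun K f ->
  test_fun K (fun z => cexp (- f z) - 1).
Proof.
move=> [bf [T fT] sf]; split.
- move=> U oU; apply: (bf ((fun w : R[i]^o => cexp (- w) - 1 : R[i]^o) @^-1` U)).
  have ce := @continuous_reflect_sub R[i] R[i]^o (@cexp R) 1 (@cexp_continuous R).
  by apply: open_comp => // z _; exact: ce.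
- exists (expR T + 1) => z; apply: le_trans (ler_cnormD _ _) _.
  rewrite cnormN (cnorm_real 1) normr1 lerD2r cnorm_cexp ler_expR.
  apply: le_trans (ler_norm _) _; apply: le_trans (Re_le_cnorm _) _.
  by rewrite cnormN.
- apply: subset_trans sf; apply: closure_subset => z /=.
  by apply: contra_neq => ->; rewrite oppr0 cexp0 subrr.
Qed.

End StateTopology.

(** * Expansion of the generating functional *)

Lemma leq_ffact2l (m n q : nat) : (m <= n)%N -> (m ^_ q <= n ^_ q)%N.
Proof.
move=> mn; elim: q => [//|q IHq]; rewrite !ffactnSr leq_mul//.
exact: leq_sub2r.
Qed.

Lemma sum_exp_coeff_le (R : realType) (x : R) (m : nat) : 0 <= x ->
  \sum_(0 <= q < m) x ^+ q / q`!%:R <= expR x.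
Proof.
move=> x0; have := @nondecreasing_cvgn_le R (series (exp_coeff x)).
move=> /(_ _ (is_cvg_series_exp_coeff x) m); apply.
by apply: nondecreasing_series => n _ _; exact: exp_coeff_ge0.
Qed.

Section ComplexSums.
Variable R : realType.

Lemma cnorm_sum I (r : seq I) (P : pred I) (F : I -> R[i]) :
  cnorm (\sum_(i <- r | P i) F i) <= \sum_(i <- r | P i) cnorm (F i).
Proof.
elim/big_ind2 : _ => [|x x' y y' xx' yy'|//]; first by rewrite (cnorm_real 0) normr0.
exact: le_trans (ler_cnormD _ _) (lerD xx' yy').
Qed.

Lemma cnorm_prod I (r : seq I) (P : pred I) (F : I -> R[i]) :
  cnorm (\prod_(i <- r | P i) F i) = \prod_(i <- r | P i) cnorm (F i).
Proof. by apply: big_morph; [exact: cnormM|rewrite (cnorm_real 1) normr1]. Qed.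

Lemma real_complex_sum I (r : seq I) (P : pred I) (F : I -> R) :
  (\sum_(i <- r | P i) F i)%:C = \sum_(i <- r | P i) (F i)%:C :> R[i].
Proof. exact: rmorph_sum. Qed.

End ComplexSums.

Section Expansion.
Variables (R : realType) (n : nat) (p : R).
Hypothesis p01 : 0 <= p <= 1.

(** A bound on the number of components that is the same for all graphs. *)
Definition nb_subsets : nat := #|{: {set 'I_n}}|.

Lemma card_component (G : graph n) : (#|{: component G}| <= nb_subsets)%N.
Proof. by rewrite card_sig max_card. Qed.

Lemma cnorm_cmean (X : graph n -> R[i]) : cnorm (cmean p X) <= mean p (fun G => cnorm (X G)).
Proof.
apply: le_trans (cnorm_sum _ _ _) _; apply: ler_sum => G _.
by rewrite cnormM cnorm_real ger0_norm// gnp_pmf_ge0.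
Qed.

Lemma cmean_real (X : graph n -> R) : cmean p (fun G => (X G)%:C) = (mean p X)%:C.
Proof. by rewrite /mean real_complex_sum; apply: eq_bigr => G _; rewrite rmorphM. Qed.

Lemma cmean_sum I (r : seq I) (P : pred I) (F : I -> graph n -> R[i]) :
  cmean p (fun G => \sum_(i <- r | P i) F i G) = \sum_(i <- r | P i) cmean p (F i).
Proof.
by rewrite /cmean exchange_big; apply: eq_bigr => G _; rewrite mulr_sumr.
Qed.

Lemma cmeanZ (c : R[i]) (X : graph n -> R[i]) : cmean p (fun G => c * X G) = c * cmean p X.
Proof. by rewrite /cmean mulr_sumr; apply: eq_bigr => G _; rewrite mulrCA. Qed.

Lemma eq_cmean (X Y : graph n -> R[i]) : X =1 Y -> cmean p X = cmean p Y.
Proof. by move=> XY; apply: eq_bigr => G _; rewrite XY. Qed.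

Lemma factorial_termE (h : state R -> R[i]) q : borel_fun h ->
  factorial_term n p h q = cmean p (fun G : graph n => (q`!%:R)^-1 *
    \sum_(t : q.-tuple (component G) | uniq t) \prod_(i < q) h (atom R (tnth t i))).
Proof.
move=> bh; rewrite cmeanZ; congr (_ * _).
have [mR mI] := measurable_prod_tnth q bh.
rewrite (complex_integral_factorial_moment n p01 mR mI); apply: eq_cmean => G.
by apply: eq_bigr => t _; apply: eq_bigr => i _; rewrite tnth_map.
Qed.

Lemma pgfE (h : state R -> R[i]) :
  pgf n p h = cmean p (fun G : graph n => \prod_(C : component G) (1 + h (atom R C))).
Proof. exact: complex_integral_gnp. Qed.

(** A graph has finitely many components, so the expansion is a finite sum. *)
Lemma pgf_partial_sum (h : state R -> R[i]) Q : borel_fun h -> (nb_subsets <= Q)%N ->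
  pgf n p h = factorial_partial_sum n p h Q.
Proof.
move=> bh nQ; rewrite pgfE /factorial_partial_sum.
under [RHS]eq_bigr do rewrite factorial_termE//.
rewrite -cmean_sum; apply: eq_cmean => G.
apply: (@prod_1D_tuples R[i] (component G) (fun C => h (atom R C))).
  exact: pchar_num.
exact: leq_trans (card_component G) nQ.
Qed.

(** Only the tuples of atoms in K contribute, each at most T^q, and there are
    as many of them as the falling factorial of the number of atoms in K. *)
Lemma cnorm_factorial_term (K : set (state R)) (h : state R -> R[i]) (T : R) q :
  borel_fun h -> (forall z, h z != 0 -> K z) -> sup_norm_le h T ->
  cnorm (factorial_term n p h q) <=
    T ^+ q / q`!%:R * mean p (fun G : graph n => (nb_atoms K G ^_ q)%:R).
Proof.
move=> bh hK hT; rewrite factorial_termE//; apply: le_trans (cnorm_cmean _) _.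
rewrite -meanZ; apply: (ler_mean p01) => G; rewrite cnormM.
have -> : cnorm ((q`!%:R)^-1 : R[i]) = (q`!%:R)^-1.
  have -> : (q`!%:R)^-1 = ((q`!%:R)^-1)%:C :> R[i] by rewrite fmorphV rmorph_nat.
  by rewrite cnorm_real ger0_norm// invr_ge0.
rewrite mulrAC [leRHS]mulrC; apply: ler_wpM2l; first by rewrite invr_ge0.
apply: le_trans (cnorm_sum _ _ _) _.
rewrite -(@sum_uniq_tuples_indicator R (component G)
  [pred C | `[< K (atom R C) >]] T q).
apply: ler_sum => t _; rewrite cnorm_prod; apply: ler_prod => i _.
rewrite cnorm_ge0/=; case: asboolP => // nK.
have [->|/hK//] := eqVneq (h (atom R (tnth t i))) 0.
by rewrite (cnorm_real 0) normr0.
Qed.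

Lemma support_sub (K : set (state R)) (h : state R -> R[i]) :
  support_in h K -> forall z, h z != 0 -> K z.
Proof. by move=> hK z hz; apply: hK; exact: subset_closure. Qed.

(** The factor exp (- c q^3) is at most exp (- c Q^3) on the whole tail, and an
    exponential series remains. *)
Lemma sum_moments_le (M : nat -> R) (C c y : R) (Q m : nat) :
  0 <= C -> 0 <= c -> 0 <= y ->
  (forall q, M q <= C ^+ q * expR (- c * q%:R ^+ 3)) ->
  \sum_(Q <= q < m) y ^+ q / q`!%:R * M q <= expR (y * C) * expR (- c * Q%:R ^+ 3).
Proof.
move=> C0 c0 y0 MC; have [mQ|Qm] := leqP m Q.
  by rewrite big_geq// mulr_ge0 ?expR_ge0.
apply: (@le_trans _ _ ((\sum_(0 <= q < m) (y * C) ^+ q / q`!%:R) * expR (- c * Q%:R ^+ 3))); last first.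
  by apply: ler_wpM2r; [exact: expR_ge0|apply: sum_exp_coeff_le; rewrite mulr_ge0].
rewrite [X in X * _](big_cat_nat (n := Q))//=; last exact: ltnW.
rewrite mulrDl ler_wpDl//.
  by rewrite mulr_ge0 ?expR_ge0// sumr_ge0// => q _; rewrite divr_ge0// exprn_ge0// mulr_ge0.
rewrite mulr_suml [leLHS]big_nat [leRHS]big_nat; apply: ler_sum => q /andP[Qq _].
have -> : (y * C) ^+ q / q`!%:R * expR (- c * Q%:R ^+ 3) =
    y ^+ q / q`!%:R * (C ^+ q * expR (- c * Q%:R ^+ 3)) by rewrite exprMn; ring.
apply: ler_wpM2l.
  by rewrite divr_ge0// exprn_ge0.
apply: le_trans (MC q) _; apply: ler_wpM2l; first by rewrite exprn_ge0.
rewrite ler_expR !mulNr lerN2; apply: ler_wpM2l => //.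
by apply: lerXn2r; rewrite ?nnegrE// ler_nat.
Qed.

End Expansion.

Section Parts.
Variables (R : realType) (lambda : R) (n0 : nat).
Hypothesis hn0 : forall n, (n0 <= n)%N -> 0 < p_crit lambda n < 1.
Variable K : set (state R).
Hypothesis hK : compact K.

Lemma p_crit01 n : (n0 <= n)%N -> 0 <= p_crit lambda n <= 1.
Proof. by move=> /hn0/andP[/ltW-> /ltW->]. Qed.

Lemma mean_ffact_nb_atoms : exists C c : R, [/\ 0 < C, 0 < c & forall n q, (n0 <= n)%N ->
  mean (p_crit lambda n) (fun G : graph n => (nb_atoms K G ^_ q)%:R) <=
  C ^+ q * expR (- c * q%:R ^+ 3)].
Proof.
have [a [b [a0 b0 Kab]]] := compact_mass hK.
have [C [c [C0 c0 H]]] := mean_ffact_nb_window a0 b0 hn0.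
exists C, c; split => // n q n0n; apply: le_trans (H n q n0n).
apply: (ler_mean (p_crit01 n0n)) => G; rewrite ler_nat leq_ffact2l//.
exact: nb_atoms_le_nb_window.
Qed.

(** Markov's inequality: (x)_m >= m! as soon as x >= m. *)
Lemma nb_atoms_tail : exists C c : R, [/\ 0 < C, 0 < c &
    forall n m : nat, (n0 <= n)%N -> (1 <= m)%N ->
      (gnp n (p_crit lambda n) [set G | m%:R%:E <= Xi R G K]
       <= (C ^+ m / m`!%:R * expR (- c * m%:R ^+ 3))%:E)%E].
Proof.
have [C [c [C0 c0 H]]] := mean_ffact_nb_atoms; exists C, c; split => // n m n0n _.
rewrite (gnpE (p_crit01 n0n)) lee_fin mulrAC ler_pdivlMr ?ltr0n ?fact_gt0//.
apply: le_trans (H n m n0n); rewrite mulrC -meanZ.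
apply: (ler_mean (p_crit01 n0n)) => G.
have [|_] := boolP (G \in _); last by rewrite mulr0.
rewrite inE/= XiE lee_fin ler_nat mulr1 ler_nat => mG.
by rewrite -bin_ffact leq_pmull// bin_gt0.
Qed.

Lemma pgf_expansion (n : nat) (h : state R -> R[i]) : (n0 <= n)%N -> test_fun K h ->
  series (factorial_term n (p_crit lambda n) h) @ \oo
    --> (pgf n (p_crit lambda n) h : R[i]^o).
Proof.
move=> n0n [bh _ _] A /nbhs_singleton Ah.
exists (nb_subsets n).+1 => // -[//|m] /= nm.
by move: Ah; rewrite (pgf_partial_sum (p_crit01 n0n) bh nm).
Qed.

Lemma pgf_truncation (T : R) : exists A d : R, 0 < d /\ uniform_truncation lambda n0 K T A d.
Proof.
have [C [c [C0 c0 H]]] := mean_ffact_nb_atoms.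
exists (expR (`|T| * C)), c; split => // Q.
apply: ub_ereal_sup => _ [n [h [n0n [bh _ sh] hT ->]]]; rewrite lee_fin.
set p := p_crit lambda n; have p01 := p_crit01 n0n.
have hT' : sup_norm_le h `|T| by move=> z; exact: le_trans (hT z) (ler_norm _).
rewrite (pgf_partial_sum p01 bh (leq_maxr Q (nb_subsets n))).
rewrite /factorial_partial_sum [X in X - _](big_cat_nat (n := Q.+1))//=; last first.
  by rewrite ltnS leq_maxl.
rewrite addrAC subrr add0r; apply: le_trans (cnorm_sum _ _ _) _.
apply: (@le_trans _ _ (\sum_(Q.+1 <= q < (maxn Q (nb_subsets n)).+1) `|T| ^+ q / q`!%:R *
    mean p (fun G : graph n => (nb_atoms K G ^_ q)%:R))).
  apply: ler_sum => q _; apply: cnorm_factorial_term => //; exact: support_sub.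
apply: le_trans (sum_moments_le _ _ (ltW C0) (ltW c0) (normr_ge0 T) (H n ^~ n0n)) _.
apply: ler_wpM2l; first exact: expR_ge0.
rewrite ler_expR !mulNr lerN2; apply: ler_wpM2l; first exact: ltW.
by apply: lerXn2r; rewrite ?nnegrE// ler_nat.
Qed.

(** For h = - 1_B the product of 1 + h is the indicator of the event that no atom
    lies in B. *)
Lemma void_probability_truncation (A d : R) : 0 < d -> uniform_truncation lambda n0 K 1 A d ->
  forall B : set (state R), measurable B -> B `<=` K ->
  forall Q : nat,
    (ereal_sup [set x | exists2 n, (n0 <= n)%N &
       x = `| void_probability n (p_crit lambda n) B -
              \sum_(0 <= q < Q.+1) (-1) ^+ q / q`!%:R *
                mean_falling n (p_crit lambda n) B q |%:E]
     <= (A * expR (- d * Q%:R ^+ 3))%:E)%E.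
Proof.
move=> _ tr B mB BK Q; apply: le_trans (tr Q).
apply: ub_ereal_sup => _ [n n0n ->].
set p := p_crit lambda n; have p01 : 0 <= p <= 1 := p_crit01 n0n.
set h := fun z : state R => if `[< B z >] then -1 else 0 : R[i].
have th : test_fun K h by exact: test_fun_indicator.
apply: ereal_sup_ubound; exists n, h; split => //.
  by move=> z; rewrite /h; case: asboolP => _; rewrite ?cnormN cnorm_real ?normr1 ?normr0.
have voidE : pgf n p h = (void_probability n p B)%:C.
  rewrite pgfE// /void_probability gnpE// /= -cmean_real; apply: eq_cmean => G.
  have [G0|G0] := boolP (G \in _).
    rewrite big1// => C _; rewrite /h; case: asboolP => BC; last by rewrite addr0.
    move: G0; rewrite inE/= XiE => -[] /eqP; rewrite pnatr_eq0 /nb_atoms => /eqP/card0_eq/(_ C).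
    by rewrite seq.inE/= asboolT.
  have : nb_atoms B G != 0%N.
    apply: contra G0 => /eqP c0; rewrite inE/= XiE c0; by [].
  rewrite -lt0n => /card_gt0P[C]; rewrite seq.inE => BC.
  by rewrite (bigD1 C)//= /h BC subrr mul0r.
have termE q : factorial_term n p h q = ((-1) ^+ q / q`!%:R * mean_falling n p B q)%:C.
  have [bh _ _] := th.
  rewrite factorial_termE// /mean_falling.
  have -> : (fun G : graph n => falling (fine (Xi R G B)) q) =
      (fun G => (nb_atoms B G ^_ q)%:R).
    by apply/funext => G; rewrite XiE/= falling_nat.
  rewrite expectation_gnp//= -meanZ -cmean_real; apply: eq_cmean => G.
  rewrite (@sum_uniq_tuples_indicator R[i] (component G)
    [pred C | `[< B (atom R C) >]] (-1) q).
  by rewrite !rmorphM/= fmorphV !rmorph_nat rmorphXn rmorphN1 mulrCA mulrA.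
rewrite voidE /factorial_partial_sum; under [in RHS]eq_bigr do rewrite termE.
by rewrite -real_complex_sum -rmorphB cnorm_real.
Qed.

Lemma laplace_pgf (f : state R -> R[i]) (n : nat) : test_fun K f -> (n0 <= n)%N ->
  laplace n (p_crit lambda n) f = pgf n (p_crit lambda n) (fun z => cexp (- f z) - 1).
Proof.
move=> [bf _ _] n0n; have p01 := p_crit01 n0n.
rewrite pgfE// /laplace complex_integral_gnp//; apply: eq_cmean => G.
rewrite complex_integral_Xi; [|exact: borel_fun_Re|exact: borel_fun_Im].
rewrite -sumrN cexp_sum; apply: eq_bigr => C _.
by rewrite addrC subrK.
Qed.

(** Expand exp (t x) = (1 + y)^x, with y = exp t - 1, in falling factorials
    of x. *)
Lemma exponential_moment (t : R) : 0 <= t ->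
    (ereal_sup [set x | exists2 n, (n0 <= n)%N &
       x = 'E_(gnp n (p_crit lambda n))[
             fun G : graph n => expR (t * fine (Xi R G K))]]
     < +oo)%E.
Proof.
move=> t0; have [C [c [C0 c0 H]]] := mean_ffact_nb_atoms.
pose y := expR t - 1; have y0 : 0 <= y by rewrite subr_ge0 -expR0 ler_expR.
apply: (@le_lt_trans _ _ (expR (y * C))%:E); last exact: ltry.
apply: ub_ereal_sup => _ [n n0n ->].
set p := p_crit lambda n; have p01 : 0 <= p <= 1 := p_crit01 n0n.
rewrite expectation_gnp// lee_fin.
rewrite (@eq_mean _ _ _ _ (fun G : graph n =>
    \sum_(q < (nb_subsets n).+1) y ^+ q / q`!%:R * (nb_atoms K G ^_ q)%:R)); last first.
  move=> G; rewrite XiE/= mulrC expRM_natl.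
  transitivity (\prod_(D : component G) (1 + (if `[< K (atom R D) >] then y else 0))).
    rewrite (bigID [pred D | `[< K (atom R D) >]])/= [X in _ * X]big1 ?mulr1; last first.
      by move=> D /negPf->; rewrite addr0.
    rewrite (eq_bigr (fun=> expR t)) ?prodr_const// => D ->.
    by rewrite /y addrC subrK.
  rewrite (prod_1D_tuples _ (@pchar_num R) (card_component G)) big_mkord.
  apply: eq_bigr => q _.
  rewrite (sum_uniq_tuples_indicator [pred D | `[< K (atom R D) >]] y q).
  by rewrite mulrA [_^-1 * _]mulrC.
rewrite mean_sum; under eq_bigr do rewrite meanZ.
rewrite -(big_mkord xpredT (fun q => y ^+ q / q`!%:R * mean p (fun G : graph n => (nb_atoms K G ^_ q)%:R))).
apply: le_trans (sum_moments_le 0 _ (ltW C0) (ltW c0) y0 (H n ^~ n0n)) _.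
by rewrite expr0n/= mulr0 expR0 mulr1.
Qed.

End Parts.

(** * The corollary *)

Unset Implicit Arguments.

Theorem corollary3p6 (R : realType) (lambda : R) (n0 : nat)
    (hn0 : forall n, (n0 <= n)%N -> 0 < p_crit lambda n < 1)
    (K : set (state R)) (hK : compact K) :
  (* (a) *)
  (exists C c : R, [/\ 0 < C, 0 < c &
    forall n m : nat, (n0 <= n)%N -> (1 <= m)%N ->
      (gnp n (p_crit lambda n) [set G | m%:R%:E <= Xi R G K]
       <= (C ^+ m / m`!%:R * expR (- c * m%:R ^+ 3))%:E)%E]) /\
  (* (b) *)
  (forall (n : nat) (h : state R -> R[i]), (n0 <= n)%N -> test_fun K h ->
    series (factorial_term n (p_crit lambda n) h) @ \oo
      --> (pgf n (p_crit lambda n) h : R[i]^o)) /\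
  (* (c) *)
  (forall T : R, exists A d : R, 0 < d /\ uniform_truncation lambda n0 K T A d) /\
  (* (d) *)
  (forall A d : R, 0 < d -> uniform_truncation lambda n0 K 1 A d ->
    forall B : set (state R), measurable B -> B `<=` K ->
    forall Q : nat,
      (ereal_sup [set x | exists2 n, (n0 <= n)%N &
         x = `| void_probability n (p_crit lambda n) B -
                \sum_(0 <= q < Q.+1) (-1) ^+ q / q`!%:R *
                  mean_falling n (p_crit lambda n) B q |%:E]
       <= (A * expR (- d * Q%:R ^+ 3))%:E)%E) /\
  (* (e) *)
  (forall f : state R -> R[i], test_fun K f ->
    let h := fun z => cexp (- f z) - 1 in
    [/\ test_fun K h,
      forall n, (n0 <= n)%N ->
        laplace n (p_crit lambda n) f = pgf n (p_crit lambda n) h &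
      forall T A d : R, sup_norm_le h T -> 0 < d ->
        uniform_truncation lambda n0 K T A d ->
        forall Q : nat,
          (ereal_sup [set x | exists2 n, (n0 <= n)%N &
             x = (cnorm (laplace n (p_crit lambda n) f -
                    factorial_partial_sum n (p_crit lambda n) h Q))%:E]
           <= (A * expR (- d * Q%:R ^+ 3))%:E)%E]) /\
  (forall t : R, 0 <= t ->
    (ereal_sup [set x | exists2 n, (n0 <= n)%N &
       x = 'E_(gnp n (p_crit lambda n))[
             fun G : graph n => expR (t * fine (Xi R G K))]]
     < +oo)%E).
Proof.
split; first exact: nb_atoms_tail.
split; first by move=> n h; exact: pgf_expansion.
split; first exact: pgf_truncation.
split; first exact: void_probability_truncation.
split; last exact: exponential_moment.
move=> f tf h; have th : test_fun K h by exact: test_fun_cexp.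
have lE n : (n0 <= n)%N -> laplace n (p_crit lambda n) f = pgf n (p_crit lambda n) h.
  by move=> n0n; exact: (laplace_pgf hn0 tf).
split => // T A d hT _ tr Q; apply: le_trans (tr Q).
apply: ub_ereal_sup => _ [n n0n ->].
by apply: ereal_sup_ubound; exists n, h; split => //; rewrite lE.
Qed.
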